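(* Let $p$ be a prime integer. Let $A$ be either $\mathbb{Z}$ or a discrete valuation ring with uniformizer $p$. Let $R$ be an essentially smooth $A$-algebra that has a $p$-derivation. Let $Q$ be a prime ideal of $R$ that contains $p$, and assume that the field extension $A/pA \hookrightarrow R_Q/QR_Q$ is separable. Then, for all $n\ge 1$, the ideal $Q^{\langle n\rangle_{\mathrm{mix}}}$ (the $n$-th mixed differential power of $Q$ with respect to a $p$-derivation $\delta$ on $R$ and $A$) is independent of the choice of the $p$-derivation $\delta$. Moreover, $$Q^{(n)}=Q^{\langle n\rangle_{\mathrm{mix}}} =\{ f \in R \mid (\eta \circ \partial)(f) \in Q \text{ for all } \eta\in \mathrm{Der}^{a}_p(R) \text{ and } \partial \in D^b_{R|A} \text{ with integers } a,b\ge 0,\ a+b\leq n-1\}.$$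
   Context: All rings are commutative with identity. A ring $S$ is essentially smooth over a subring $B$ if the inclusion $B\to S$ is formally smooth and $S$ is a localization of a finitely generated $B$-algebra. Field extensions are not assumed algebraic; ''separable'' is in the general sense. For a prime ideal $Q$ of a ring $R$ and $n\ge 1$, the $n$-th symbolic power of $Q$ is $Q^{(n)} = Q^nR_Q\cap R$ (the preimage of $Q^nR_Q$ under $R\to R_Q$). For a ring map $A\to R$, the sets of $A$-linear differential operators on $R$ of order at most $n$ are defined inductively: $D^0_{R|A}=\mathrm{Hom}_R(R,R)\subseteq \mathrm{Hom}_A(R,R)$ (multiplications by elements of $R$), and for $n\ge 1$, $D^n_{R|A}=\{\partial\in \mathrm{Hom}_A(R,R) \mid [\partial,f]=\partial\circ f-f\circ\partial\in D^{n-1}_{R|A} \text{ for all } f\in D^0_{R|A}\}$. For a prime integer $p$ and a ring $R$ on which $p$ is a nonzerodivisor, a $p$-derivation on $R$ is a set-theoretic map $\delta:R\to R$ such that $x\mapsto x^p+p\,\delta(x)$ is a ring homomorphism $R\to R$. Write $\delta^s$ for the $s$-fold self-composition of $\delta$, with $\delta^0=\mathrm{id}$. (In the setting of the claim, $R$ is $p$-torsion free.) Let $\mathrm{Der}_p(R)$ be the set of $p$-derivations on $R$ and, for an integer $a\ge 0$, let $\mathrm{Der}_p^a(R)=\{\delta_1\circ\cdots\circ\delta_t\mid \delta_i\in\mathrm{Der}_p(R) \text{ for all } i,\ 0\le t\le a\}$, where the empty composition ($t=0$) is the identity. The $n$-th mixed differential power of an ideal $I$ of $R$ (with respect to $\delta$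 and $A$) is $$I^{\langle n\rangle_{\mathrm{mix}}}=\{f\in R\mid (\delta^s\circ\partial)(f)\in I \text{ for all integers } s,t\ge 0 \text{ with } s+t\le n-1 \text{ and all } \partial\in D^t_{R|A}\}.$$ *)

(* Defs.v *)
From HB Require Import structures.
From mathcomp Require Import all_boot all_order all_algebra.
From mathcomp Require Import separable.
From mathcomp Require Import mpoly.
From mathcomp Require Import boolp classical_sets.

Set Implicit Arguments.
Unset Strict Implicit.
Unset Printing Implicit Defensive.

Import GRing.Theory.

Local Open Scope classical_set_scope.
Local Open Scope ring_scope.

Definition gen_ideal (R : comNzRingType) (S : set R) : set R :=
  [set x | exists (n : nat) (a s : 'I_n -> R),
     (forall i, S (s i)) /\ x = \sum_(i < n) a i * s i].

Fixpoint ideal_pow (R : comNzRingType) (I : set R) (n : nat) : set R :=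
  if n is n'.+1 then gen_ideal [set x * y | x in I & y in ideal_pow I n']
  else setT.

(* f exhibits S as a model of the quotient ring R / I. *)
Definition is_quotient (R S : comNzRingType) (I : set R)
    (f : {rmorphism R -> S}) : Prop :=
  (forall y, exists x, f x = y) /\ (forall x, f x = 0 <-> I x).

Definition multiplicative_set (R : comNzRingType) (W : set R) : Prop :=
  W 1 /\ (forall x y, W x -> W y -> W (x * y)).

(* f exhibits S as a model of the localization W^-1 R. *)
Definition is_localization (R S : comNzRingType) (W : set R)
    (f : {rmorphism R -> S}) : Prop :=
  [/\ multiplicative_set W,
      forall w, W w -> exists y, f w * y = 1,
      forall y, exists x w, W w /\ y * f w = f x
    & forall x, f x = 0 -> exists2 w, W w & w * x = 0].

Definition is_localization_at (R RQ : comNzRingType) (Q : prime_idealr R)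
    (loc : {rmorphism R -> RQ}) : Prop :=
  is_localization [set x | x \notin Q] loc.

(* The extension I RQ of I along loc. *)
Definition ideal_ext (R RQ : comNzRingType) (loc : {rmorphism R -> RQ})
    (I : set R) : set RQ :=
  gen_ideal (loc @` I).

Definition symbolic_power (R RQ : comNzRingType) (loc : {rmorphism R -> RQ})
    (Q : prime_idealr R) (n : nat) : set R :=
  loc @^-1` ideal_ext loc (ideal_pow [set` Q] n).

Definition iso_int (A : comNzRingType) : Prop :=
  exists f : {rmorphism int -> A}, bijective f.

(* [idealr A] is the type of proper ideals of A; the unit ideal is always
   principal, so it need not be mentioned. *)
Definition principal_ideals (A : comNzRingType) : Prop :=
  forall I : idealr A, exists a : A, [set` I] = gen_ideal [set a].

Definition maximal_ideal (A : comNzRingType) (m : idealr A) : Prop :=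
  forall J : idealr A, {subset m <= J} -> {subset J <= m}.

(* A local principal ideal domain which is not a field. *)
Definition discrete_valuation_ring (A : idomainType) : Prop :=
  principal_ideals A /\
  exists m : idealr A,
    [/\ maximal_ideal m, exists2 x, x \in m & x != 0
      & forall m' : idealr A, maximal_ideal m' -> m' =i m].

Definition uniformizer (A : idomainType) (t : A) : Prop :=
  forall m : idealr A, maximal_ideal m -> [set` m] = gen_ideal [set t].

(* Lifting along all surjections of A-algebras with square-zero kernel,
   i.e. along all B -> B / J with J ^ 2 = 0.  Since [comAlgType] only has
   nonzero rings, the case B / J = 0 is absent, but then B = J, so that
   1 = 1 * 1 is in J ^ 2 = 0 and the lifting is trivial. *)
Definition formally_smooth (A : comNzRingType) (S : comAlgType A) : Prop :=
  forall (B C : comAlgType A) (pi : {lrmorphism B -> C}),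
    (forall c, exists b, pi b = c) ->
    (forall x y, pi x = 0 -> pi y = 0 -> x * y = 0) ->
    forall u : {lrmorphism S -> C},
      exists v : {lrmorphism S -> B}, forall s, pi (v s) = u s.

Definition finitely_generated_algebra (A : comNzRingType) (T : comAlgType A)
    : Prop :=
  exists (n : nat) (g : 'I_n -> T), forall t : T,
    exists q : {mpoly A[n]}, t = mmap (in_alg T) g q.

Definition essentially_finite_type (A : comNzRingType) (S : comAlgType A)
    : Prop :=
  exists (T : comAlgType A) (W : set T) (f : {lrmorphism T -> S}),
    finitely_generated_algebra T /\ is_localization W f.

(* Injectivity of the structure map says that A is a subring of S. *)
Definition essentially_smooth (A : comNzRingType) (S : comAlgType A) : Prop :=
  [/\ injective (in_alg S), formally_smooth S & essentially_finite_type S].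

Section Separability.
Variables (k K : fieldType) (iota : {rmorphism k -> K}).

(* k(S); a [divringClosed] predicate on a field is a subfield. *)
Definition adjoin (S : set K) : set K :=
  [set x | forall F : divringClosed K,
     (forall c, iota c \in F) -> (forall s, S s -> s \in F) -> x \in F].

Definition alg_independent (X : set K) : Prop :=
  forall (n : nat) (v : 'I_n -> K), injective v -> (forall i, X (v i)) ->
    forall q : {mpoly k[n]}, mmap iota v q = 0 -> q = 0.

Definition minimal_polynomial (F : set K) (z : K) (f : {poly K}) : Prop :=
  [/\ f \is monic, forall i, F f`_i, root f z
    & forall g : {poly K}, (forall i, F g`_i) -> root g z -> f %| g].

Definition separable_algebraic (F : set K) (z : K) : Prop :=
  exists2 f, minimal_polynomial F z f & separable_poly f.

(* L, an intermediate field, has a transcendence basis X over k such that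
   L / k(X) is separable algebraic. *)
Definition separably_generated (L : set K) : Prop :=
  exists X : set K, [/\ X `<=` L, alg_independent X
    & forall z, L z -> separable_algebraic (adjoin X) z].

(* Every finitely generated subextension is separably generated. *)
Definition separable_extension : Prop :=
  forall s : seq K, separably_generated (adjoin [set` s]).

End Separability.

(* D^0 = Hom_R(R, R) *)
Definition diffop0 (R : comNzRingType) : set (R -> R) :=
  [set d | exists a : R, d = (fun x => a * x)].

Fixpoint diffop (A : comNzRingType) (R : comAlgType A) (n : nat)
    : set (R -> R) :=
  if n is n'.+1 then
    [set d | linear d /\ forall g : R -> R, diffop0 g ->
       @diffop A R n' (fun x => d (g x) - g (d x))]
  else @diffop0 R.

Definition p_derivation (p : nat) (R : comNzRingType) (delta : R -> R) : Prop :=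
  let phi := fun x => x ^+ p + p%:R * delta x in
  zmod_morphism phi /\ monoid_morphism phi.

Fixpoint p_derivation_comp (p : nat) (R : comNzRingType) (t : nat)
    : set (R -> R) :=
  if t is t'.+1 then
    [set delta \o eta | delta in @p_derivation p R
                      & eta in @p_derivation_comp p R t']
  else [set id].

Definition Der_p (p : nat) (R : comNzRingType) (a : nat) : set (R -> R) :=
  [set eta | exists2 t, (t <= a)%N & @p_derivation_comp p R t eta].

Definition mixed_power (A : comNzRingType) (R : comAlgType A)
    (delta : R -> R) (I : set R) (n : nat) : set R :=
  [set f | forall s t : nat, (s + t <= n - 1)%N ->
     forall d, @diffop A R t d -> I ((iter s delta \o d) f)].

Definition full_mixed_power (p : nat) (A : comNzRingType) (R : comAlgType A)
    (I : set R) (n : nat) : set R :=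
  [set f | forall a b : nat, (a + b <= n - 1)%N ->
     forall eta d, Der_p p a eta -> @diffop A R b d -> I ((eta \o d) f)].

(* Main.v *)
Require Import Defs.
From HB Require Import structures.
From mathcomp Require Import all_boot all_order all_algebra.
From mathcomp Require Import boolp classical_sets.
From mathcomp Require Import ring zify generic_quotient ring_quotient separable mpoly.

Import GRing.Theory.
Local Open Scope classical_set_scope.
Local Open Scope ring_scope.

Set Implicit Arguments.
Unset Strict Implicit.
Unset Printing Implicit Defensive.

(** Write [m] for the maximal ideal of [R_Q].  Differential operators of order
    [t] and [t]-fold compositions of p-derivations lower the symbolic order of
    an element by at most [t] ([diffop_symb], [p_derivation_comp_symb]); hence
    the symbolic power is contained in both mixed powers, and it remains to see
    that an element [f] of exact order [N] is detected by some [delta^a d] with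
    [d] of order [N - a] ([mixed_symb]).

    The leading form of [f] in [m^N / m^(N+1)] is a sum of terms [p^a h] with
    [h] a product of [N - a] elements of [Q].  The iterate [delta^a] brings
    [p^a u] with [u] a unit down to a unit ([iter_pder_unit]).  So all that is
    needed are enough differential operators: if every operator of order [b]
    sends [h] in [Q^b] into [Q], then [h] is in [p m^(b-1) + m^(b+1)]
    ([operators_detect]).

    The operators come from smoothness.  Let [y_1, ..., y_m] generate [R] up to
    localization.  A section of a presentation of [R], which exists modulo any
    power of the kernel, turns the substitution [q (y + X)] into a ring
    homomorphism [V] from [R] to truncated polynomials in [X] over [R]
    ([smooth_taylor]).  The coefficient of [X^alpha] in [V] is a differential
    operator of order [|alpha|] ([taylor_diffop]): these are Hasse derivatives,
    available in every characteristic.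

    That they suffice comes from separability.  It provides a retraction [tau]
    of [R_Q] onto a coefficient field modulo [m^2 + (p)] ([coefficient_field]).
    Put [zeta_i = y_i - tau (y_i)], an element of [m].  Since
    [q (y - zeta) = tau (q (y))] for polynomials [q], the substitution
    [X = - zeta] in [V r] gives [tau r] modulo [m^2 + (p)]; for [r] in [Q] the
    latter vanishes, so that the linear part of [V r] at [zeta] is [r] itself
    ([Phi1]).  As [V] is multiplicative, the part of degree [b] of [V h] at
    [zeta] is [h] modulo [p m^(b-1) + m^(b+1)], for [h] in [Q^b]
    ([Phi_leading]).  If the coefficients of degree [b] of [V h] lie in [Q],
    this part is also in [m^(b+1)].  No coordinates need to be chosen.

    The rules for p-derivations require [R] to be [p]-torsion free.  This is the
    flatness of smooth algebras, proved by lifting a torsion element along the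
    sections of a presentation and using that Rees algebras of noetherian rings
    are noetherian ([smooth_regular]). *)

(** * Ideals and their powers *)

Definition is_ideal (R : comNzRingType) (I : set R) : Prop :=
  [/\ I 0, forall x y, I x -> I y -> I (x + y) & forall a x, I x -> I (a * x)].

Section Ideals.
Variable R : comNzRingType.
Implicit Types I J K : set R.

Lemma ideal0 I : is_ideal I -> I 0. Proof. by case. Qed.

Lemma idealD I x y : is_ideal I -> I x -> I y -> I (x + y).
Proof. by case=> _ h _; apply: h. Qed.

Lemma ideal_mull I a x : is_ideal I -> I x -> I (a * x).
Proof. by case=> _ _ h; apply: h. Qed.

Lemma ideal_mulr I a x : is_ideal I -> I x -> I (x * a).
Proof. by move=> iI Ix; rewrite mulrC; apply: ideal_mull. Qed.

Lemma idealN I x : is_ideal I -> I x -> I (- x).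
Proof. by move=> iI Ix; rewrite -mulN1r; apply: ideal_mull. Qed.

Lemma idealB I x y : is_ideal I -> I x -> I y -> I (x - y).
Proof. by move=> iI Ix Iy; apply: idealD => //; apply: idealN. Qed.

Lemma ideal_sum I (T : Type) (r : seq T) (P : pred T) (F : T -> R) :
  is_ideal I -> (forall i, P i -> I (F i)) -> I (\sum_(i <- r | P i) F i).
Proof.
move=> iI IF; elim/big_ind: _ => //; first exact: ideal0.
by move=> x y; apply: idealD.
Qed.

(** Throughout, congruence of [x] and [y] modulo [I] is written [I (x - y)]. *)
Lemma ideal_subK I x y : is_ideal I -> I (x - y) -> I y -> I x.
Proof. by move=> iI h Iy; rewrite -(subrK y x); apply: idealD. Qed.

Lemma ideal_subC I x y : is_ideal I -> I (x - y) -> I (y - x).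
Proof. by move=> iI h; rewrite -opprB; apply: idealN. Qed.

Lemma ideal_trans I y x z : is_ideal I -> I (x - y) -> I (y - z) -> I (x - z).
Proof. by move=> iI h1 h2; rewrite -(subrKA y x); apply: idealD. Qed.

Lemma ideal_mul_congr I x x' y y' :
  is_ideal I -> I (x - x') -> I (y - y') -> I (x * y - x' * y').
Proof.
move=> iI h h'; have -> : x * y - x' * y' = y * (x - x') + x' * (y - y') by ring.
by apply: idealD => //; apply: ideal_mull.
Qed.

Lemma ideal_add_congr I x x' y y' :
  is_ideal I -> I (x - x') -> I (y - y') -> I ((x + y) - (x' + y')).
Proof. by move=> iI h h'; rewrite opprD addrACA; apply: idealD. Qed.

Lemma gen_ideal_ideal (S : set R) : is_ideal (gen_ideal S).
Proof.
split.
- by exists 0%N, (fun=> 0), (fun=> 0); split; [case | rewrite big_ord0].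
- move=> _ _ [n1 [a1 [s1 [h1 ->]]]] [n2 [a2 [s2 [h2 ->]]]].
  exists (n1 + n2)%N, (fun i => match split i with inl j => a1 j | inr j => a2 j end),
    (fun i => match split i with inl j => s1 j | inr j => s2 j end); split.
    by move=> i; case: (split i).
  rewrite big_split_ord; congr (_ + _); apply: eq_bigr => i _.
    by rewrite -[lshift _ _]/(unsplit (inl i)) unsplitK.
  by rewrite -[rshift _ _]/(unsplit (inr i)) unsplitK.
- move=> c _ [n [a [s [h ->]]]]; exists n, (fun i => c * a i), s; split=> //.
  by rewrite mulr_sumr; apply: eq_bigr => i _; rewrite mulrA.
Qed.

Lemma gen_ideal_sub (S : set R) : S `<=` gen_ideal S.
Proof.
move=> x Sx; exists 1%N, (fun=> 1), (fun=> x); split=> //.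
by rewrite big_ord1 mul1r.
Qed.

Lemma gen_ideal_ind (S : set R) (I : set R) :
  is_ideal I -> S `<=` I -> gen_ideal S `<=` I.
Proof.
move=> iI SI _ [n [a [s [h ->]]]]; apply: ideal_sum => // i _.
by apply: ideal_mull => //; apply: SI.
Qed.

Lemma gen_ideal1 (a x : R) : gen_ideal [set a] x <-> exists c, x = c * a.
Proof.
split=> [|[c ->]]; last first.
  by apply: ideal_mull; [exact: gen_ideal_ideal | exact: gen_ideal_sub].
move: x; apply: gen_ideal_ind => [|_ ->]; last by exists 1; rewrite mul1r.
split; first by exists 0; rewrite mul0r.
  by move=> _ _ [c ->] [d ->]; exists (c + d); rewrite mulrDl.
by move=> b _ [c ->]; exists (b * c); rewrite mulrA.
Qed.

Lemma ideal_pow_ideal I n : is_ideal (ideal_pow I n).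
Proof. by case: n => [|n]; [split | exact: gen_ideal_ideal]. Qed.
Hint Resolve ideal_pow_ideal : core.
#[local] Arguments ideal_pow : simpl never.

Lemma ideal_powS I n x y : I x -> ideal_pow I n y -> ideal_pow I n.+1 (x * y).
Proof. by move=> Ix Iy; apply: gen_ideal_sub; exists x => //; exists y. Qed.

Lemma ideal_pow_ind I n J :
  is_ideal J -> (forall x y, I x -> ideal_pow I n y -> J (x * y)) ->
  ideal_pow I n.+1 `<=` J.
Proof.
by move=> iJ h; apply: gen_ideal_ind => // _ [x Ix] [y Iy] <-; apply: h.
Qed.

(** Additive properties need only be checked on products, as coefficients
    can be absorbed in the second factor. *)
Lemma ideal_pow_ind_add I n (P : set R) :
  P 0 -> (forall x y, P x -> P y -> P (x + y)) ->
  (forall x y, I x -> ideal_pow I n y -> P (x * y)) ->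
  ideal_pow I n.+1 `<=` P.
Proof.
move=> P0 PD PM _ [m [a [s [hs ->]]]]; elim/big_ind: _ => // i _.
have [x Ix [y Iy <-]] := hs i; rewrite mulrCA; apply: PM => //.
exact: ideal_mull.
Qed.

Lemma ideal_pow_subS I n : ideal_pow I n.+1 `<=` ideal_pow I n.
Proof. by apply: ideal_pow_ind => // x y _ Iy; apply: ideal_mull. Qed.

Lemma ideal_pow_le I m n : (m <= n)%N -> ideal_pow I n `<=` ideal_pow I m.
Proof.
move/subnK <-; elim: (n - m)%N => // k IH x /ideal_pow_subS; exact: IH.
Qed.

Lemma ideal_powD I m n x y :
  ideal_pow I m x -> ideal_pow I n y -> ideal_pow I (m + n) (x * y).
Proof.
elim: m x => [|m IH] x; first by move=> _ Iy; rewrite add0n; apply: ideal_mull.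
move=> + Iy; rewrite addSn.
have iJ : is_ideal [set x | ideal_pow I (m + n).+1 (x * y)].
  split=> [|u v|a u] /=; first by rewrite mul0r; apply: ideal0.
    by move=> h1 h2; rewrite mulrDl; apply: idealD.
  by move=> h; rewrite -mulrA; apply: ideal_mull.
apply: (ideal_pow_ind iJ) => u v Iu Iv /=; rewrite -mulrA.
by apply: ideal_powS => //; apply: IH.
Qed.

Lemma ideal_pow1 I : is_ideal I -> ideal_pow I 1 = I.
Proof.
move=> iI; apply/seteqP; split=> x.
  by apply: ideal_pow_ind => // u v Iu _; apply: ideal_mulr.
by move=> Ix; rewrite -[x]mulr1; apply: ideal_powS.
Qed.

Lemma ideal_powX I x n : I x -> ideal_pow I n (x ^+ n).
Proof. by move=> Ix; elim: n => // n IH; rewrite exprS; apply: ideal_powS. Qed.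

End Ideals.
#[local] Hint Resolve ideal_pow_ideal : core.
#[local] Arguments ideal_pow : simpl never.

(** * The symbolic filtration of a prime ideal *)

Section SymbolicFiltration.
Variables (R : comNzRingType) (Q : prime_idealr R).

Lemma prime_ideal_ideal : is_ideal [set` Q].
Proof.
split=> [|x y|a x] /=; [exact: rpred0 | exact: rpredD | exact: idealMr].
Qed.
Hint Resolve prime_ideal_ideal : core.

Lemma notin_primeM x y : x \notin Q -> y \notin Q -> x * y \notin Q.
Proof. by move=> hx hy; rewrite prime_idealrM negb_or hx. Qed.

Lemma notin_prime1 : 1 \notin Q. Proof. by rewrite idealr1. Qed.

Lemma notin_primeX x n : x \notin Q -> x ^+ n \notin Q.
Proof.
by move=> hx; elim: n => [|n IH]; rewrite ?notin_prime1 // exprS notin_primeM.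
Qed.

(** The symbolic power, read in [R] itself: denominators outside [Q] replace
    the passage to the local ring. *)
Definition symb n : set R :=
  [set f | exists2 w, w \notin Q & ideal_pow [set` Q] n (w * f)].

Lemma pow_symb n : ideal_pow [set` Q] n `<=` symb n.
Proof. by move=> x h; exists 1; rewrite ?notin_prime1 ?mul1r. Qed.

Lemma symb_ideal n : is_ideal (symb n).
Proof.
split.
- by exists 1; rewrite ?notin_prime1 // mulr0; apply: ideal0.
- move=> x y [w hw hx] [v hv hy]; exists (w * v); first exact: notin_primeM.
  have -> : w * v * (x + y) = v * (w * x) + w * (v * y) by ring.
  by apply: idealD => //; apply: ideal_mull.
- by move=> a x [w hw hx]; exists w => //; rewrite mulrCA; apply: ideal_mull.
Qed.
Hint Resolve symb_ideal : core.

Lemma symb_le m n : (m <= n)%N -> symb n `<=` symb m.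
Proof. by move=> mn x [w hw /(ideal_pow_le mn) h]; exists w. Qed.

Lemma symb_cancel n w x : w \notin Q -> symb n (w * x) -> symb n x.
Proof.
by move=> hw [v hv h]; exists (v * w); rewrite ?notin_primeM // -mulrA.
Qed.

Lemma symbM m n x y : symb m x -> symb n y -> symb (m + n) (x * y).
Proof.
move=> [w hw hx] [v hv hy]; exists (w * v); first exact: notin_primeM.
by rewrite mulrACA; apply: ideal_powD.
Qed.

Lemma symb1 : symb 1 = [set` Q].
Proof.
apply/seteqP; split=> x; rewrite /symb ideal_pow1 //=.
  by case=> w hw; rewrite /= prime_idealrM (negbTE hw).
by move=> hx; exists 1; rewrite ?notin_prime1 ?mul1r.
Qed.

Lemma symb_sum_unit x y : x \notin Q -> y \in Q -> x + y \notin Q.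
Proof. by move=> hx hy; apply: contra hx => h; rewrite -(addrK y x) rpredB. Qed.

End SymbolicFiltration.
#[local] Hint Resolve prime_ideal_ideal symb_ideal : core.

(** * The local ring at a prime ideal *)

Section LocalRing.
Variables (R RQ : comNzRingType) (Q : prime_idealr R).
Variables (loc : {rmorphism R -> RQ}) (hloc : is_localization_at Q loc).

Lemma loc_unit w : w \notin Q -> exists y, loc w * y = 1.
Proof. by case: hloc => _ h _ _; apply: h. Qed.

Definition loc_pow n : set RQ := ideal_ext loc (ideal_pow [set` Q] n).

Lemma loc_pow_ideal n : is_ideal (loc_pow n). Proof. exact: gen_ideal_ideal. Qed.
Hint Resolve loc_pow_ideal : core.

Lemma loc_powP n x : loc_pow n x <->
  exists w h, [/\ w \notin Q, ideal_pow [set` Q] n h & x * loc w = loc h].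
Proof.
split=> [|[w [h [hw hh e]]]]; last first.
  have [y hy] := loc_unit hw.
  rewrite -[x]mulr1 -hy mulrA e mulrC; apply: ideal_mull => //.
  by apply: gen_ideal_sub; exists h.
move: x; apply: gen_ideal_ind => [|_ [h hh <-]]; last first.
  by exists 1, h; rewrite notin_prime1 rmorph1 mulr1.
split.
- by exists 1, 0; rewrite notin_prime1 rmorph0 mul0r; split=> //; apply: ideal0.
- move=> x y [w [h [hw hh e]]] [w' [h' [hw' hh' e']]].
  exists (w * w'), (w' * h + w * h'); split; first exact: notin_primeM.
    by apply: idealD => //; apply: ideal_mull.
  by rewrite rmorphD !rmorphM -e -e' /=; ring.
- move=> a x [w [h [hw hh e]]]; case: hloc => _ _ frac _.
  have [b [v [/= hv eb]]] := frac a; exists (v * w), (b * h); split.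
  + exact: notin_primeM.
  + exact: ideal_mull.
  + by rewrite !rmorphM -eb -e /=; ring.
Qed.

Lemma loc_pow_symb n f : loc_pow n (loc f) <-> symb Q n f.
Proof.
split=> [/loc_powP[w [h [hw hh e]]]|[w hw h]]; last first.
  by apply/loc_powP; exists w, (w * f); split=> //; rewrite mulrC rmorphM.
case: hloc => _ _ _ ker; have [|v /= hv e'] := ker (f * w - h).
  by rewrite rmorphB rmorphM e subrr.
exists (v * w); first exact: notin_primeM.
have -> : v * w * f = v * (f * w - h) + v * h by ring.
by rewrite e' add0r; apply: ideal_mull.
Qed.

Lemma symbolic_power_symb n : symbolic_power loc Q n = symb Q n.
Proof. by apply/seteqP; split=> f /loc_pow_symb. Qed.

Lemma loc_pow_le m n : (m <= n)%N -> loc_pow n `<=` loc_pow m.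
Proof.
move=> mn x /loc_powP[w [h [hw hh e]]]; apply/loc_powP; exists w, h; split=> //.
exact: ideal_pow_le hh.
Qed.

Lemma loc_pow0 x : loc_pow 0 x.
Proof.
case: hloc => _ _ frac _; have [b [v [/= hv eb]]] := frac x.
by apply/loc_powP; exists v, b.
Qed.

Lemma loc_powM m n x y : loc_pow m x -> loc_pow n y -> loc_pow (m + n) (x * y).
Proof.
move=> /loc_powP[w [h [hw hh e]]] /loc_powP[w' [h' [hw' hh' e']]].
apply/loc_powP; exists (w * w'), (h * h'); split; first exact: notin_primeM.
  exact: ideal_powD.
by rewrite !rmorphM -e -e' /=; ring.
Qed.

Section Residue.
Variables (K : fieldType) (piQ : {rmorphism RQ -> K}).
Hypothesis hK : is_quotient (ideal_ext loc [set` Q]) piQ.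

Lemma residue0 x : piQ x = 0 <-> loc_pow 1 x.
Proof. by case: hK => _ h; rewrite /loc_pow ideal_pow1 //; apply: h. Qed.

Lemma residue_loc x : piQ (loc x) = 0 <-> x \in Q.
Proof. by rewrite residue0 loc_pow_symb symb1. Qed.

Lemma local_unit x : piQ x != 0 -> exists y, x * y = 1.
Proof.
move=> hx; case: hloc => _ _ frac _; have [b [v [/= hv e]]] := frac x.
have hb : b \notin Q.
  apply: contra hx => /residue_loc; rewrite -e rmorphM => /eqP.
  by rewrite mulf_eq0 => /orP[//|/eqP/residue_loc]; rewrite (negbTE hv).
have [y hy] := loc_unit hb; exists (loc v * y); by rewrite mulrA e.
Qed.

End Residue.
End LocalRing.
#[local] Hint Resolve loc_pow_ideal : core.

(** * The action of p-derivations on symbolic powers *)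

(** The explicit factor [x * y] is what makes p-derivations additive up to terms
    of higher order. *)
Lemma freshman_cross (R : comNzRingType) p (x y : R) : prime p ->
  exists c, (x + y) ^+ p = x ^+ p + y ^+ p + p%:R * (x * y * c).
Proof.
move=> p_pr; case: p p_pr => // p p_pr.
rewrite exprDn big_ord_recl big_ord_recr /= /bump /= !add1n.
rewrite subn0 expr0 mulr1 bin0 mulr1n subnn expr0 mul1r binn mulr1n.
case: p p_pr => // p p_pr.
exists (\sum_(i < p.+1) (x ^+ (p - i) * y ^+ i) *+ ('C(p.+2, i.+1) %/ p.+2)).
rewrite -!addrA; congr (_ + _); rewrite [RHS]addrC; congr (_ + _).
rewrite 2!mulr_sumr; apply: eq_bigr => i _.
have dv : (p.+2 %| 'C(p.+2, i.+1))%N.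
  by apply: prime_dvd_bin => //; have := ltn_ord i; lia.
rewrite !add1n subSS subSn; last by rewrite -ltnS.
rewrite -{1}(divnK dv) mulrnA -(mulr_natl _ p.+2) !exprS.
by do 2!rewrite -[_ *+ (_ %/ _)]mulr_natl; ring.
Qed.

Section PDerivation.
Variables (R : comNzRingType) (p : nat) (Q : prime_idealr R).
Hypotheses (p_prime : prime p) (pQ : p%:R \in Q).
Hypothesis p_reg : forall x : R, p%:R * x = 0 -> x = 0.

Section OneDerivation.
Variables (delta : R -> R) (hdelta : p_derivation p delta).

Definition frob_lift x := x ^+ p + p%:R * delta x.

Lemma frob_lift0 : frob_lift 0 = 0.
Proof.
have : frob_lift (0 - 0) = frob_lift 0 - frob_lift 0 := hdelta.1 0 0.
by rewrite !subrr.
Qed.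

Lemma frob_liftD x y : frob_lift (x + y) = frob_lift x + frob_lift y.
Proof.
have hB u v : frob_lift (u - v) = frob_lift u - frob_lift v := hdelta.1 u v.
have hN z : frob_lift (- z) = - frob_lift z by rewrite -sub0r hB frob_lift0 sub0r.
by rewrite -[y in x + y]opprK hB hN opprK.
Qed.

Lemma frob_liftM x y : frob_lift (x * y) = frob_lift x * frob_lift y.
Proof. exact: hdelta.2.2. Qed.

Lemma frob_lift1 : frob_lift 1 = 1.
Proof. exact: hdelta.2.1. Qed.

Lemma frob_lift_nat n : frob_lift n%:R = n%:R.
Proof.
elim: n => [|n IH]; first exact: frob_lift0.
by rewrite -addn1 natrD frob_liftD IH [frob_lift 1%:R]frob_lift1.
Qed.

Lemma p_cancel (x y : R) : p%:R * x = p%:R * y -> x = y.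
Proof. by move=> h; apply/subr0_eq/p_reg; rewrite mulrBr h subrr. Qed.

Lemma pder_frob x : p%:R * delta x = frob_lift x - x ^+ p.
Proof. by rewrite /frob_lift addrC addKr. Qed.

Lemma pder0 : delta 0 = 0.
Proof.
apply: p_reg; rewrite pder_frob frob_lift0 expr0n.
by rewrite eqn0Ngt prime_gt0 // subr0.
Qed.

Lemma pderD x y : exists c, delta (x + y) = delta x + delta y - x * y * c.
Proof.
have [c hc] := freshman_cross x y p_prime; exists c; apply: p_cancel.
rewrite pder_frob frob_liftD hc mulrBr mulrDr !pder_frob; ring.
Qed.

Lemma pderM x y : delta (x * y) = frob_lift x * delta y + y ^+ p * delta x.
Proof.
apply: p_cancel; rewrite mulrDr !(mulrCA p%:R) !pder_frob frob_liftM exprMn.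
ring.
Qed.

(** As [frob_lift v] is [v ^+ p] modulo [p], a p-derivation lowers the order
    in [p] by exactly one; for [v = p ^ a * u] the last term is negligible. *)
Lemma pder_pM (v : R) : delta (p%:R * v) = frob_lift v - p%:R ^+ p.-1 * v ^+ p.
Proof.
apply: p_cancel; rewrite pder_frob frob_liftM frob_lift_nat mulrBr mulrA.
by rewrite -exprS prednK ?prime_gt0 // exprMn.
Qed.

Lemma frob_lift_Q x : (frob_lift x \in Q) = (x \in Q).
Proof.
apply/idP/idP=> h.
  have : x ^+ p \in Q.
    by rewrite -(addrK (p%:R * delta x) (x ^+ p)) rpredB // mulrC idealMr.
  by apply: contraLR => /notin_primeX.
rewrite /frob_lift rpredD //; last by rewrite mulrC idealMr.
by rewrite -(prednK (prime_gt0 p_prime)) exprSr idealMr.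
Qed.

Lemma pder_pow n x : ideal_pow [set` Q] n.+1 x -> ideal_pow [set` Q] n (delta x).
Proof.
elim: n x => // n IH x hx.
suff [] : ideal_pow [set` Q] n.+2 x /\ ideal_pow [set` Q] n.+1 (delta x) by [].
move: x hx; apply: ideal_pow_ind_add => [|u v [hu hu'] [hv hv']|u v hu hv].
- by rewrite pder0; split; apply: ideal0.
- split; first exact: idealD.
  have [c ->] := pderD u v; apply: idealB => //; first exact: idealD.
  by do 2!apply: ideal_mulr => //; apply: ideal_pow_subS.
- split; first exact: ideal_powS.
  rewrite pderM; apply: idealD => //.
    by apply: ideal_powS; [rewrite /= frob_lift_Q | apply: IH].
  by rewrite -(prednK (prime_gt0 p_prime)) exprS; do 2!apply: ideal_mulr => //.
Qed.

(** The product rule for [w * x] isolates [delta x] with the coefficient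
    [frob_lift w], which stays outside [Q] because [p] is in [Q]. *)
Lemma pder_symb n x : symb Q n.+1 x -> symb Q n (delta x).
Proof.
case=> w hw hx; exists (w * frob_lift w).
  by rewrite notin_primeM // frob_lift_Q.
have -> : w * frob_lift w * delta x =
    w * delta (w * x) - w * (x ^+ p * delta w) by rewrite pderM; ring.
apply: idealB => //; first by apply: ideal_mull => //; apply: pder_pow.
apply: ideal_pow_subS; rewrite mulrA; apply: ideal_mulr => //.
by rewrite -(prednK (prime_gt0 p_prime)) exprS mulrA; apply: ideal_mulr.
Qed.

Lemma natX_symb a : symb Q a (p%:R ^+ a).
Proof. by apply: pow_symb; apply: ideal_powX. Qed.

(** [delta] detects the exact order of [p ^ a * u]: its [a]-fold iterate
    brings this element, and anything close to it, down to a unit at [Q]. *)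
Lemma iter_pder_unit a u e : u \notin Q -> symb Q a.+1 e ->
  iter a delta (p%:R ^+ a * u + e) \notin Q.
Proof.
elim: a u e => [|a IH] u e hu he.
  by rewrite mul1r symb_sum_unit //; move: he; rewrite symb1.
rewrite iterSr exprS -mulrA.
have [c ->] := pderD (p%:R * (p%:R ^+ a * u)) e.
rewrite pder_pM frob_liftM.
have -> : frob_lift (p%:R ^+ a) = p%:R ^+ a.
  by rewrite -natrX frob_lift_nat.
set b := p%:R ^+ p.-1 * _; set d := p%:R * _ * e * c.
have -> : p%:R ^+ a * frob_lift u - b + delta e - d
        = p%:R ^+ a * frob_lift u + (delta e - b - d) by ring.
apply: IH; first by rewrite frob_lift_Q.
apply: idealB => //; first apply: idealB => //.
- exact: pder_symb.
- rewrite /b exprMn -exprM mulrA -exprD; apply: ideal_mulr => //.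
  apply: symb_le (natX_symb _); case: p p_prime => [|[|q]] //= _.
  by rewrite mulnS addSn ltnS addnCA leq_addr.
- by rewrite /d; apply: ideal_mulr => //; apply: ideal_mull => //;
    apply: symb_le he.
Qed.

End OneDerivation.

Lemma p_derivation_comp_symb t (eta : R -> R) n x :
  p_derivation_comp p t eta -> symb Q n x -> symb Q (n - t) (eta x).
Proof.
elim: t eta => [|t IH] eta /=; first by move=> ->; rewrite subn0.
case=> delta hd [eta' he <-] hx; have := IH _ he hx.
rewrite subnS; case: (n - t)%N => [|k] /= h; last exact: (pder_symb hd).
by exists 1; rewrite ?notin_prime1.
Qed.

Lemma iter_p_derivation_comp (delta : R -> R) s :
  p_derivation p delta -> p_derivation_comp p s (iter s delta).
Proof.
move=> hd; elim: s => [|s IH] /=; first by apply/funext.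
by exists delta => //; exists (iter s delta).
Qed.

End PDerivation.

(** * The action of differential operators on symbolic powers *)

Section DifferentialOperators.
Variables (A : comNzRingType) (R : comAlgType A) (Q : prime_idealr R).
Implicit Types d : R -> R.

Lemma diffop_linear t d : @diffop A R t d -> linear d.
Proof.
case: t => [[a ->] c x y|t [] //].
by rewrite mulrDr -scalerAr.
Qed.

Lemma linear_diffopD d x y : linear d -> d (x + y) = d x + d y.
Proof. by move=> h; rewrite -[x]scale1r h !scale1r. Qed.

Lemma linear_diffop0 d : linear d -> d 0 = 0.
Proof.
by move=> h; apply: (addrI (d 0)); rewrite -linear_diffopD // !addr0.
Qed.

Lemma diffop_comm t d a :
  @diffop A R t.+1 d -> @diffop A R t (fun x => d (a * x) - a * d x).
Proof. by case=> _ h; apply: (h (fun x => a * x)); exists a. Qed.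

Lemma diffop_id : @diffop A R 0 (@id R).
Proof. by exists 1; apply/funext => x; rewrite mul1r. Qed.

Lemma diffop_premul t d w : @diffop A R t d -> @diffop A R t (fun x => d (w * x)).
Proof.
elim: t d => [d [a ->]|t IH d hd].
  by exists (a * w); apply/funext => x; rewrite mulrA.
split=> [c x y|_ [a ->]].
  by rewrite mulrDr -scalerAr (diffop_linear hd).
have := IH _ (diffop_comm a hd).
by congr (@diffop A R t _); apply/funext => x; rewrite mulrCA.
Qed.

(** By induction on the order, as the commutator with a multiplication has
    smaller order; it absorbs both the factors in [Q] and the denominators. *)
Lemma diffop_symb t d n x : @diffop A R t d -> symb Q n x -> symb Q (n - t) (d x).
Proof.
elim: t d n x => [d n x [a ->]|t IH d n x hd hx].
  by rewrite subn0; apply: ideal_mull.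
have lin := diffop_linear hd.
have step k : ideal_pow [set` Q] k `<=` [set y | symb Q (k - t.+1) (d y)].
  elim: k => [|k IHk]; first by move=> y _; exists 1; rewrite ?notin_prime1.
  apply: ideal_pow_ind_add => /= [|y z hy hz|u v hu hv].
  - by rewrite linear_diffop0 //; apply: ideal0.
  - by rewrite linear_diffopD //; apply: idealD.
  have -> : d (u * v) = u * d v + (d (u * v) - u * d v) by ring.
  have hdv := IHk _ hv; have hv' := pow_symb hv.
  apply: idealD => //; last by rewrite subSS; exact: (IH _ _ _ (diffop_comm u hd) hv').
  have hu1 : symb Q 1 u by rewrite symb1.
  by apply: symb_le (symbM hu1 hdv); rewrite add1n subSS; lia.
case: hx => w hw hx; apply: (symb_cancel hw).
have -> : w * d x = d (w * x) - (d (w * x) - w * d x) by ring.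
have h1 := step _ _ hx; apply: idealB => //.
apply: (symb_le (leq_sub2l n (leqnSn t))); apply: (IH _ _ _ (diffop_comm w hd)).
by exists w.
Qed.

End DifferentialOperators.
(** * Noetherian rings *)

(** The ascending chain condition, in the form of a statement about sequences:
    this is the shape in which it is used, and it passes to quotients at once. *)
Definition noetherian (R : comNzRingType) : Prop :=
  forall u : nat -> R, exists N (c : nat -> R), u N = \sum_(i < N) c i * u i.

Lemma mem_mkseqP (T : eqType) (f : nat -> T) n x :
  reflect (exists2 i, (i < n)%N & x = f i) (x \in mkseq f n).
Proof.
by apply: (iffP mapP) => -[i hi ->]; exists i; rewrite // ?mem_iota in hi *.
Qed.

Section Span.
Variables (R : comNzRingType) (u : nat -> R).

Definition span n : set R := [set x | exists c : nat -> R, x = \sum_(i < n) c i * u i].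

Lemma span_ideal n : is_ideal (span n).
Proof.
split.
- by exists (fun=> 0); rewrite big1 // => i _; rewrite mul0r.
- move=> _ _ [c ->] [d ->]; exists (fun i => c i + d i).
  by rewrite -big_split; apply: eq_bigr => i _; rewrite mulrDl.
- move=> a _ [c ->]; exists (fun i => a * c i).
  by rewrite mulr_sumr; apply: eq_bigr => i _; rewrite mulrA.
Qed.

Lemma span_mem n i : (i < n)%N -> span n (u i).
Proof.
move=> lt_in; exists (fun j => (j == i)%:R).
rewrite (bigD1 (Ordinal lt_in)) //= eqxx mul1r big1 ?addr0 // => j.
by move=> ne; rewrite (negbTE (ne : (j : nat) != i)) mul0r.
Qed.

Lemma span_le m n : (m <= n)%N -> span m `<=` span n.
Proof.
move=> le_mn _ [c ->]; apply: ideal_sum => [|i _]; first exact: span_ideal.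
apply: ideal_mull; [exact: span_ideal | apply: span_mem].
exact: leq_trans (ltn_ord i) le_mn.
Qed.

Lemma gen_range_span : gen_ideal (range u) `<=` [set x | exists n, span n x].
Proof.
apply: gen_ideal_ind => [|_ [i _ <-]]; last by exists i.+1; apply: span_mem.
split; first by exists 0%N; apply: ideal0; apply: span_ideal.
  move=> x y [m hm] [n hn]; exists (maxn m n); apply: idealD.
  - exact: span_ideal.
  - by apply: span_le hm; rewrite leq_maxl.
  - by apply: span_le hn; rewrite leq_maxr.
by move=> a x [n hn]; exists n; apply: ideal_mull => //; apply: span_ideal.
Qed.

End Span.

(** Dependent choice, with access to the whole history. *)
Lemma history_choice (T : eqType) (P : seq T -> T -> Prop) :
  (forall l, exists x, P l x) ->
  exists f : nat -> T, forall k, P (mkseq f k) (f k).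
Proof.
move=> /choice[next hnext].
pose fix L k := if k is k'.+1 then rcons (L k') (next (L k')) else [::].
exists (fun k => next (L k)) => k.
have -> : mkseq (fun k => next (L k)) k = L k.
  by elim: k => // k IH; rewrite mkseqS IH.
exact: hnext.
Qed.

Definition fg_ideal (R : comNzRingType) (I : set R) : Prop :=
  exists2 l : seq R, [set` l] `<=` I & I `<=` gen_ideal [set` l].

Lemma noetherian_fg (R : comNzRingType) (I : set R) :
  noetherian R -> is_ideal I -> fg_ideal I.
Proof.
move=> noe iI; apply: contrapT => nfg.
have ext (l : seq R) : exists x, [set` l] `<=` I -> I x /\ ~ gen_ideal [set` l] x.
  apply: contrapT => h; apply: nfg; exists l.
    by move=> x lx; apply: contrapT => Ix; apply: h; exists 0 => /(_ x lx).
  move=> x Ix; apply: contrapT => nx; apply: h.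
  by exists x.
have [f hf] := history_choice ext.
have If k : I (f k).
  elim/ltn_ind: k => k IH; apply: (hf k _).1 => _ /= /mem_mkseqP[i hi ->].
  exact: IH.
have [N [c e]] := noe f.
have [] := (hf N _).2; first by move=> _ /= /mem_mkseqP[i _ ->]; apply: If.
rewrite e; apply: ideal_sum => [|i _]; first exact: gen_ideal_ideal.
apply: ideal_mull; first exact: gen_ideal_ideal.
by apply: gen_ideal_sub => /=; apply/mem_mkseqP; exists i.
Qed.

Lemma fg_noetherian (R : comNzRingType) :
  (forall I : set R, is_ideal I -> fg_ideal I) -> noetherian R.
Proof.
move=> fg u; have [l lu ul] := fg _ (gen_ideal_ideal (range u)).
have [n hn] : exists n, [set` l] `<=` span u n.
  elim: l lu {ul} => [|x l IH] lu; first by exists 0%N.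
  have /IH[n hn] : [set` l] `<=` gen_ideal (range u).
    by move=> y hy; apply: lu; rewrite /= inE hy orbT.
  have [m hm] := gen_range_span (lu x (mem_head _ _)).
  exists (maxn m n) => y /=; rewrite inE => /predU1P[->|hy].
    by apply: span_le hm; rewrite leq_maxl.
  by apply: span_le (hn _ hy); rewrite leq_maxr.
have [c e] : span u n (u n).
  apply: (gen_ideal_ind (span_ideal u n) hn); apply: ul.
  by apply: gen_ideal_sub; exists n.
by exists n, c.
Qed.

Lemma noetherian_surj (R S : comNzRingType) (f : {rmorphism R -> S}) :
  (forall y, exists x, f x = y) -> noetherian R -> noetherian S.
Proof.
move=> /choice[g hg] noe u; have [N [c e]] := noe (g \o u).
exists N, (f \o c); rewrite -(hg (u N)) [g (u N)]e rmorph_sum; apply: eq_bigr => i _.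
by rewrite rmorphM /= hg.
Qed.

Lemma size_lead_cancel (R : comNzRingType) (q : {poly R}) (s : {poly R}) :
  q != 0 -> (size s <= size q)%N -> s`_(size q).-1 = lead_coef q ->
  (size (q - s)%R < size q)%N.
Proof.
move=> q0 hs e; have q_gt0 : (0 < size q)%N by rewrite size_poly_gt0.
rewrite -[X in (_ < X)%N](prednK q_gt0) ltnS; apply/leq_sizeP => j hj.
rewrite coefB; case: (ltngtP j (size q).-1) hj => // [hj _|-> _].
  by rewrite !nth_default ?subrr //; first apply: leq_trans hs _; rewrite -(prednK q_gt0).
by rewrite e /lead_coef subrr.
Qed.

(** Hilbert's basis theorem.  In an ideal without finite generating set one
    picks repeatedly an element of least degree outside what is already
    generated; a relation between the leading coefficients then produces an
    element of smaller degree that should have been picked. *)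
Lemma noetherian_poly (R : comNzRingType) : noetherian R -> noetherian {poly R}.
Proof.
move=> noe; apply: fg_noetherian => I iI; apply: contrapT => nfg.
pose new (l : seq {poly R}) x := I x /\ ~ gen_ideal [set` l] x.
have ext (l : seq {poly R}) : exists x : {poly R}, [set` l] `<=` I ->
    new l x /\ forall y, new l y -> (size x <= size y)%N.
  have [lI|nlI] := pselect ([set` l] `<=` I); last by exists 0.
  have : exists n, `[< exists2 x, new l x & size x = n >].
    apply: contrapT => h; apply: nfg; exists l => // x Ix.
    apply: contrapT => nx; apply: h; exists (size x); apply/asboolP.
    by exists x.
  case/ex_minnP => n /asboolP[x hx <-] hmin; exists x => _; split=> // y hy.
  by apply: hmin; apply/asboolP; exists y.
have [f hf] := history_choice ext.
have If k : I (f k).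
  elim/ltn_ind: k => k IH; have [_ /= /mem_mkseqP[i hi ->]|[] //] := hf k.
  exact: IH.
have fI k : [set` mkseq f k] `<=` I by move=> _ /= /mem_mkseqP[i _ ->].
have fnew k := (hf k (fI k)).1; have fmin k := (hf k (fI k)).2.
have fmono i k : (i <= k)%N -> (size (f i) <= size (f k))%N.
  move=> le_ik; apply: fmin; split=> // h; apply: (fnew k).2.
  apply: gen_ideal_ind h; first exact: gen_ideal_ideal.
  move=> _ /= /mem_mkseqP[j hj ->]; apply: gen_ideal_sub => /=; apply/mem_mkseqP.
  by exists j => //; apply: leq_trans le_ik.
have fN0 k : f k != 0.
  by apply/eqP => h; apply: (fnew k).2; rewrite h; apply: ideal0; apply: gen_ideal_ideal.
have [N [c e]] := noe (lead_coef \o f).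
pose g := \sum_(i < N) c i *: (f i * 'X^(size (f N) - size (f i))).
have gspan : gen_ideal [set` mkseq f N] g.
  apply: ideal_sum => [|i _]; first exact: gen_ideal_ideal.
  rewrite -mul_polyC mulrCA; apply: ideal_mulr; first exact: gen_ideal_ideal.
  by apply: gen_ideal_sub => /=; apply/mem_mkseqP; exists i.
have gI : I g.
  by apply: ideal_sum => // i _; rewrite -mul_polyC mulrCA; apply: ideal_mulr.
have : (size (f N - g)%R < size (f N))%N.
  apply: size_lead_cancel => //.
    apply: (leq_trans (size_sum _ _ _)); apply/bigmax_leqP => i _.
    apply: (leq_trans (size_scale_leq _ _)); rewrite size_mulXn //.
    by rewrite subnK // fmono // ltnW.
  rewrite coef_sum; rewrite /= in e; rewrite e; apply: eq_bigr => i _.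
  rewrite coefZ coefMXn; have lei : (size (f i) <= size (f N))%N by rewrite fmono // ltnW.
  have : (0 < size (f i))%N by rewrite size_poly_gt0.
  move=> i_gt0; rewrite ifF; last by apply/negbTE; lia.
  by rewrite /lead_coef; congr (_ * _`_ _); lia.
rewrite ltnNge => /negP; apply; apply: fmin; split; first exact: idealB.
move=> h; apply: (fnew N).2; rewrite -(subrK g (f N)).
by apply: idealD => //; apply: gen_ideal_ideal.
Qed.

(** A finitely generated subalgebra is the image of an iterated polynomial ring;
    the last clause is the induction principle for that image. *)
Lemma noetherian_cover (B S : comNzRingType) (psi : {rmorphism B -> S})
    (l : seq S) : noetherian B ->
  exists (N : comNzRingType) (f : {rmorphism N -> S}),
    [/\ noetherian N, forall b, exists x, f x = psi b,
        forall s, s \in l -> exists x, f x = s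
      & forall P : set S, (forall x y, P x -> P y -> P (x + y)) ->
          (forall x y, P x -> P y -> P (x * y)) ->
          (forall b, P (psi b)) -> (forall s, s \in l -> P s) ->
          forall x, P (f x)].
Proof.
move=> noeB; elim: l => [|s l [N [f [noeN hb hl hP]]]].
  by exists B, psi; split=> // b; exists b.
have cfs : commr_rmorph f s by move=> x; apply: mulrC.
exists {poly N}, (horner_morph cfs); split.
- exact: noetherian_poly.
- by move=> b; have [x <-] := hb b; exists x%:P; rewrite /= horner_morphC.
- move=> t; rewrite inE => /predU1P[->|/hl[x <-]].
    by exists 'X; rewrite /= horner_morphX.
  by exists x%:P; rewrite /= horner_morphC.
- move=> P PD PM Pb Pl; elim/poly_ind => [|q c IH].
    by rewrite rmorph0 -(rmorph0 psi).
  rewrite rmorphD rmorphM /= horner_morphX horner_morphC; apply: (PD).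
    by apply: PM; [exact: IH | apply: Pl; rewrite mem_head].
  by apply: (hP P PD PM Pb) => t ht; apply: Pl; rewrite inE ht orbT.
Qed.

Lemma principal_noetherian (A : comNzRingType) :
  (forall I : set A, is_ideal I -> exists a, I = gen_ideal [set a]) ->
  noetherian A.
Proof.
move=> h; apply: fg_noetherian => I iI; have [a e] := h I iI.
exists [:: a]; rewrite e; last first.
  by apply: gen_ideal_ind => [|_ ->]; [exact: gen_ideal_ideal|apply: gen_ideal_sub; exact: mem_head].
by move=> x /=; rewrite inE => /eqP->; apply: gen_ideal_sub.
Qed.

Lemma int_principal (I : set int) :
  is_ideal I -> exists a, I = gen_ideal [set a].
Proof.
move=> iI; have [[x Ix x0]|h] := pselect (exists2 x, I x & x != 0); last first.
  exists 0; apply/seteqP; split=> x.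
    move=> Ix; apply/gen_ideal1; exists 0; rewrite mulr0; apply: contrapT => x0.
    by apply: h; exists x => //; apply/eqP.
  by move/gen_ideal1 => [c ->]; rewrite mulr0; apply: ideal0.
have : exists n, `[< exists2 a : int, I a /\ a != 0 & `|a|%N = n >].
  by exists `|x|%N; apply/asboolP; exists x.
case/ex_minnP => n /asboolP[a [Ia a0] <-] hmin; exists a.
apply/seteqP; split=> y; last first.
  by move/gen_ideal1 => [c ->]; apply: ideal_mull.
move=> Iy; apply/gen_ideal1; exists (y %/ a)%Z.
have e := divz_eq y a; have Ir : I (y %% a)%Z.
  have -> : (y %% a)%Z = y - (y %/ a)%Z * a by rewrite {2}e addrC addKr.
  by apply: idealB => //; apply: ideal_mull.
rewrite {1}e; have [->|r0] := eqVneq (y %% a)%Z 0; first by rewrite addr0.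
have /hmin : `[< exists2 b : int, I b /\ b != 0 & `|b|%N = `|(y %% a)%Z|%N >].
  by apply/asboolP; exists (y %% a)%Z.
have := modz_ge0 y a0; have := ltz_mod y a0; lia.
Qed.

(** * Formal smoothness in terms of congruences *)

(** Bundling functions that are only known to be morphisms inside a proof. *)
Section BuildMorphisms.
Variables (X Y : comNzRingType) (f : X -> Y).
Hypotheses (fB : zmod_morphism f) (f1 : monoid_morphism f).

Definition build_rmorphism_fun of zmod_morphism f & monoid_morphism f := f.

HB.instance Definition _ :=
  GRing.isZmodMorphism.Build X Y (build_rmorphism_fun fB f1) fB.
HB.instance Definition _ :=
  GRing.isMonoidMorphism.Build X Y (build_rmorphism_fun fB f1) f1.

Definition build_rmorphism : {rmorphism X -> Y} := build_rmorphism_fun fB f1.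
End BuildMorphisms.

Section BuildAlgebraMorphisms.
Variables (A : comNzRingType) (X Y : comAlgType A) (f : X -> Y).
Hypotheses (fB : zmod_morphism f) (f1 : monoid_morphism f) (fZ : scalable f).

Definition build_lrmorphism_fun of
  zmod_morphism f & monoid_morphism f & scalable f := f.

HB.instance Definition _ :=
  GRing.isZmodMorphism.Build X Y (build_lrmorphism_fun fB f1 fZ) fB.
HB.instance Definition _ :=
  GRing.isMonoidMorphism.Build X Y (build_lrmorphism_fun fB f1 fZ) f1.
HB.instance Definition _ :=
  GRing.isScalable.Build A X Y *:%R (build_lrmorphism_fun fB f1 fZ) fZ.

Definition build_lrmorphism : {lrmorphism X -> Y} :=
  build_lrmorphism_fun fB f1 fZ.
End BuildAlgebraMorphisms.

(** The ring [B], made an [A]-algebra by restriction of scalars along [j]. *)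
Section RestrictScalars.
Variables (A B : comNzRingType) (j : {rmorphism A -> B}).

Definition restrict_scalars of {rmorphism A -> B} : Type := B.
Local Notation Bj := (restrict_scalars j).

HB.instance Definition _ := GRing.ComNzRing.on Bj.

Definition restricted_scale (a : A) (b : Bj) : Bj := (j a : B) * b.

Lemma restricted_scaleA a b v :
  restricted_scale a (restricted_scale b v) = restricted_scale (a * b) v.
Proof. by rewrite /restricted_scale rmorphM mulrA. Qed.

Lemma restricted_scale1 : left_id 1 restricted_scale.
Proof. by move=> v; rewrite /restricted_scale rmorph1 mul1r. Qed.

Lemma restricted_scaleDr : right_distributive restricted_scale +%R.
Proof. by move=> a u v; rewrite /restricted_scale mulrDr. Qed.

Lemma restricted_scaleDl v : {morph restricted_scale^~ v : a b / a + b}.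
Proof. by move=> a b; rewrite /restricted_scale rmorphD mulrDl. Qed.

HB.instance Definition _ := GRing.Zmodule_isLmodule.Build A Bj
  restricted_scaleA restricted_scale1 restricted_scaleDr restricted_scaleDl.

Lemma restricted_scaleAl (a : A) (u v : Bj) : a *: (u * v) = (a *: u) * v.
Proof. exact: mulrA. Qed.

HB.instance Definition _ :=
  GRing.Lmodule_isLalgebra.Build A Bj restricted_scaleAl.

Lemma restricted_scaleAr (a : A) (u v : Bj) : a *: (u * v) = u * (a *: v).
Proof. exact: (@mulrCA B). Qed.

HB.instance Definition _ :=
  GRing.Lalgebra_isAlgebra.Build A Bj restricted_scaleAr.

Definition restricted_algebra : comAlgType A := Bj.

End RestrictScalars.


Section QuotientRing.
Variables (B : comNzRingType) (J : set B) (iJ : is_ideal J) (J1 : ~ J 1).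

Definition ideal_pred of is_ideal J & ~ J 1 : {pred B} := fun x => `[< J x >].
Local Notation Jp := (ideal_pred iJ J1).

Lemma ideal_predP : idealr_closed Jp.
Proof.
split; first by apply/asboolP; apply: ideal0.
  by apply/negP => /asboolP.
move=> a x y /asboolP hx /asboolP hy; apply/asboolP.
by apply: (idealD iJ) => //; apply: (ideal_mull a iJ).
Qed.

HB.instance Definition _ := isIdealr.Build B Jp ideal_predP.

Lemma quotient_exists :
  exists (C : comNzRingType) (q : {rmorphism B -> C}), is_quotient J q.
Proof.
exists {ideal_quot Jp}, (\pi_{ideal_quot Jp})%qT; split=> [y|x].
  by exists (repr y); apply: reprK.
have e : (x \in Jp) = (\pi_({ideal_quot Jp}) x == 0)%qT.
  by rewrite -[in RHS](rmorph0 (\pi_{ideal_quot Jp})%qT) -Quotient.idealrBE subr0.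
split=> [h|Jx]; first by apply/asboolP; rewrite -[`[< _ >]]/(x \in Jp) e h.
by apply/eqP; rewrite -e; apply/asboolP.
Qed.

End QuotientRing.

(** Ring homomorphisms into [B / J], represented by functions into [B]; the
    structure maps of two [A]-algebras are carried along, so that these are
    the [A]-algebra homomorphisms. *)
Definition hom_mod (A : comNzRingType) (R : comAlgType A) (B : comNzRingType)
    (j : A -> B) (J : set B) (U : R -> B) : Prop :=
  [/\ forall x y, J (U (x + y) - (U x + U y)),
      forall x y, J (U (x * y) - U x * U y)
    & forall a, J (U a%:A - j a)].

Section HomMod.
Variables (A : comNzRingType) (R : comAlgType A) (B : comNzRingType).
Variables (j : {rmorphism A -> B}) (J : set B) (U : R -> B).
Hypotheses (iJ : is_ideal J) (hU : hom_mod j J U).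

Lemma hom_mod0 : J (U 0).
Proof. by case: hU => _ _ h; have := h 0; rewrite scale0r rmorph0 subr0. Qed.

Lemma hom_mod1 : J (U 1 - 1).
Proof. by case: hU => _ _ h; have := h 1; rewrite scale1r rmorph1. Qed.

Lemma hom_modB x y : J (U (x - y) - (U x - U y)).
Proof.
case: hU => hD _ _; have := hD (x - y) y; rewrite subrK => /(idealN iJ).
by congr J; ring.
Qed.

Lemma hom_mod_scale a x : J (U (a *: x) - j a * U x).
Proof.
case: hU => _ hM hA; rewrite -{1}[x]mul1r scalerAl.
apply: (ideal_trans iJ (hM _ _)); rewrite -mulrBl.
exact: ideal_mulr.
Qed.

End HomMod.

(** The lifting property of formally smooth algebras, without quotient rings:
    a homomorphism modulo an ideal [J2] can be corrected to one modulo [J1],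
    as long as the square of [J2] lies in [J1]. *)
Lemma smooth_lift_mod (A : comNzRingType) (R : comAlgType A)
    (B : comNzRingType) (j : {rmorphism A -> B}) (J1 J2 : set B) (U : R -> B) :
  formally_smooth R -> is_ideal J1 -> is_ideal J2 -> J1 `<=` J2 -> ~ J2 1 ->
  (forall x y, J2 x -> J2 y -> J1 (x * y)) ->
  hom_mod j J2 U ->
  exists2 V : R -> B, hom_mod j J1 V & forall r, J2 (V r - U r).
Proof.
move=> smooth iJ1 iJ2 J12 J2_1 sq hU.
have J1_1 : ~ J1 1 by move/J12.
have [C1 [q1 [q1_surj q1_ker]]] := quotient_exists iJ1 J1_1.
have [C2 [q2 [q2_surj q2_ker]]] := quotient_exists iJ2 J2_1.
have q2P x y : J2 (x - y) <-> q2 x = q2 y.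
  rewrite -q2_ker rmorphB; split=> [/subr0_eq //|->]; exact: subrr.
have q1P x y : J1 (x - y) <-> q1 x = q1 y.
  rewrite -q1_ker rmorphB; split=> [/subr0_eq //|->]; exact: subrr.
have /choice[s hs] := q1_surj.
have pi_q x : q2 (s (q1 x)) = q2 x by apply/q2P/J12/q1P; rewrite hs.
pose j1 := q1 \o j; pose j2 := q2 \o j.
pose D1 := restricted_algebra j1; pose D2 := restricted_algebra j2.
have piB : zmod_morphism (q2 \o s : D1 -> D2).
  move=> x y; rewrite /= -[x in LHS]hs -[y in LHS]hs -rmorphB pi_q.
  exact: rmorphB.
have piM : monoid_morphism (q2 \o s : D1 -> D2).
  split; first by rewrite /= -(rmorph1 q1) pi_q; exact: rmorph1.
  move=> x y; rewrite /= -[x in LHS]hs -[y in LHS]hs -rmorphM pi_q.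
  exact: rmorphM.
have piZ : scalable (q2 \o s : D1 -> D2).
  move=> a x; rewrite /= -[x in LHS]hs -[_ *: _]/(q1 (j a) * q1 (s x)).
  by rewrite -rmorphM pi_q rmorphM.
case: (hU) => hD hM hA.
have uB : zmod_morphism (q2 \o U : R -> D2).
  by move=> x y /=; rewrite -[RHS]rmorphB; apply/q2P; apply: hom_modB hU _ _.
have uM : monoid_morphism (q2 \o U : R -> D2).
  split=> [|x y] /=; first by rewrite -[RHS](rmorph1 q2); apply/q2P; apply: hom_mod1 hU.
  by rewrite -[RHS]rmorphM; apply/q2P.
have uZ : scalable (q2 \o U : R -> D2).
  move=> a x /=; rewrite -[RHS]/(q2 (j a) * q2 (U x)) -rmorphM.
  by apply/q2P; apply: hom_mod_scale hU _ _.
have [||v hv] := smooth D1 D2 (build_lrmorphism piB piM piZ) _ _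
    (build_lrmorphism uB uM uZ).
- by move=> c; have [b <-] := q2_surj c; exists (q1 b); apply: pi_q.
- move=> x y; rewrite -[x]hs -[y]hs => hx hy.
  rewrite -[LHS]rmorphM; apply/q1_ker; apply: sq; apply/q2_ker.
    by rewrite -hx; apply/esym/pi_q.
  by rewrite -hy; apply/esym/pi_q.
exists (s \o v) => [|r]; last by apply/q2P; apply: (hv r).
split=> [x y|x y|a]; apply/q1P; rewrite /= hs.
- by rewrite [RHS]rmorphD !hs; exact: (rmorphD v).
- by rewrite [RHS]rmorphM !hs; exact: (rmorphM v).
- by rewrite rmorph_alg -[LHS]/(q1 (j a) * 1) mulr1.
Qed.

(** * Localized polynomial rings *)

Lemma mpoly_ring_ind (n : nat) (R : comNzRingType) (P : {mpoly R[n]} -> Prop) :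
  (forall c, P c%:MP) -> (forall i, P 'X_i) ->
  (forall x y, P x -> P y -> P (x + y)) -> (forall x y, P x -> P y -> P (x * y)) ->
  forall q, P q.
Proof.
move=> PC PX PD PM q; rewrite (mpolyE q).
elim/big_ind: _ => [|x y|m _]; [by rewrite -mpolyC0| exact: PD |].
rewrite -mul_mpolyC; apply: (PM) => //; rewrite mpolyXE_id.
elim/big_ind: _ => [|x y|i _]; [by rewrite -mpolyC1 | exact: PM |].
by elim: (m i) => [|k IH]; rewrite ?expr0 -?mpolyC1 // exprS; apply: PM.
Qed.

Lemma noetherian_mpoly (A : comNzRingType) n :
  noetherian A -> noetherian {mpoly A[n]}.
Proof.
move=> noeA.
have [N [f [noeN fC fX _]]] := noetherian_cover (@mpolyC n A)
  [seq 'X_i | i : 'I_n] noeA.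
apply: (noetherian_surj _ noeN); apply: mpoly_ring_ind; first exact: fC.
- by move=> i; apply: fX; apply/mapP; exists i; rewrite // mem_enum.
- by move=> _ _ [x <-] [y <-]; exists (x + y); rewrite rmorphD.
- by move=> _ _ [x <-] [y <-]; exists (x * y); rewrite rmorphM.
Qed.

Lemma ess_finite_presentation (A : comNzRingType) (R : comAlgType A) :
  essentially_finite_type R ->
  exists m (ev : {rmorphism {mpoly A[m]} -> R}),
    (forall a, ev a%:MP = a%:A) /\
    (forall r, exists q q', (exists u, ev q' * u = 1) /\ r * ev q' = ev q).
Proof.
case=> T [W [f [[m [g hg]] [_ Wunit Wfrac _]]]].
exists m, (f \o mmap (in_alg T) g)%FUN; split=> [a|r].
  by rewrite /= mmapC rmorph_alg.
have [x [w [Ww e]]] := Wfrac r.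
have [q eq] := hg x; have [q' eq'] := hg w; exists q, q'.
by rewrite /= -eq -eq'; split=> //; apply: Wunit.
Qed.

Section LocalizedCover.
Variables (A : idomainType) (R : comNzRingType) (m : nat).
Variable ev : {rmorphism {mpoly A[m]} -> R}.

Local Notation P := {mpoly A[m]}.
Local Notation S := (R * {fraction P})%type.

(** The graph, inside [R * Frac(P)], of the extension of [ev] to the ring of
    those fractions whose denominator becomes invertible in [R]: a model of the
    localization of [P], whose two projections are the map to [R] and the
    embedding in a field. *)
Definition frac_graph : {pred S} :=
  fun b => `[< exists q q', [/\ exists u, ev q' * u = 1,
    b.1 * ev q' = ev q & b.2 * tofrac q' = tofrac q] >].

Lemma frac_graph_subring : subring_closed frac_graph.
Proof.
split.
- by apply/asboolP; exists 1, 1; split; rewrite ?mul1r //; exists 1; rewrite rmorph1 mul1r.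
- move=> x y /asboolP[q [q' [[u hu] h1 h2]]] /asboolP[s [s' [[v hv] h3 h4]]].
  apply/asboolP; exists (q * s' - s * q'), (q' * s'); split.
  + by exists (u * v); rewrite rmorphM mulrACA hu hv mulr1.
  + by rewrite /= rmorphB !rmorphM -h1 -h3 /=; ring.
  + by rewrite /= tofracB !tofracM -h2 -h4 /=; ring.
- move=> x y /asboolP[q [q' [[u hu] h1 h2]]] /asboolP[s [s' [[v hv] h3 h4]]].
  apply/asboolP; exists (q * s), (q' * s'); split.
  + by exists (u * v); rewrite rmorphM mulrACA hu hv mulr1.
  + by rewrite /= !rmorphM -h1 -h3 /=; ring.
  + by rewrite /= !tofracM -h2 -h4 /=; ring.
Qed.

HB.instance Definition _ :=
  GRing.isSubringClosed.Build S frac_graph frac_graph_subring.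

Definition frac_ring : Type := {b : S | frac_graph b}.
HB.instance Definition _ := SubChoice.on frac_ring.
HB.instance Definition _ := [SubChoice_isSubComNzRing of frac_ring by <:].

Let frac_pair_proof q : frac_graph (ev q, tofrac q).
Proof.
apply/asboolP; exists q, 1; split; first by exists 1; rewrite rmorph1 mulr1.
  by rewrite rmorph1 mulr1.
by rewrite tofrac1 mulr1.
Qed.

Let frac_pair q : frac_ring := exist (fun b => frac_graph b) _ (frac_pair_proof q).

Let frac_pairB : zmod_morphism frac_pair.
Proof. by move=> x y; apply: val_inj; rewrite /= rmorphB tofracB. Qed.

Let frac_pairM : monoid_morphism frac_pair.
Proof.
split=> [|x y]; apply: val_inj; first by rewrite /= rmorph1 tofrac1.
by rewrite /= rmorphM tofracM.
Qed.

(** [R] as a quotient of a noetherian ring [B] that is torsion-free over [A]: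
    the localization of a polynomial ring at all denominators that become
    invertible in [R]. *)
Lemma localized_cover :
  noetherian A -> (forall r, exists q q', (exists u, ev q' * u = 1) /\
    r * ev q' = ev q) ->
  exists (B : comNzRingType) (e : {rmorphism P -> B}) (eps : {rmorphism B -> R}),
    [/\ noetherian B, forall a b, a != 0 -> e a%:MP * b = 0 -> b = 0,
        forall q, eps (e q) = ev q, injective e /\ forall r, exists b, eps b = r
      & forall b, exists q q', (exists u, ev q' * u = 1) /\ b * e q' = e q].
Proof.
move=> noeA frac.
pose eps b : R := (val (b : frac_ring)).1.
have epsB : zmod_morphism eps by [].
have epsM : monoid_morphism eps by [].
pose e := build_rmorphism frac_pairB frac_pairM.
have den0 q : (exists u, ev q * u = 1) -> q != 0.
  by case=> u; apply: contra_eq_neq => ->; rewrite rmorph0 mul0r eq_sym oner_eq0.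
have e_unit q : (exists u, ev q * u = 1) -> exists u, e q * u = 1.
  move=> hq; have q0 := den0 _ hq; case: hq => u hu.
  have hu' : frac_graph (u, (tofrac q)^-1).
    apply/asboolP; exists 1, q; split; first by exists u.
      by rewrite mulrC hu rmorph1.
    by rewrite tofrac1 mulVf // tofrac_eq0.
  exists (exist (fun b => frac_graph b) _ hu' : frac_ring); apply: val_inj; rewrite /= -[RHS]/(1, 1).
  by congr pair => //=; rewrite mulfV // tofrac_eq0.
have hfrac b : exists q q', (exists u, ev q' * u = 1) /\ b * e q' = e q.
  case: b => -[r F] hb; have /asboolP[q [q' [hq' /= h1 h2]]] := hb.
  by exists q, q'; split=> //; apply: val_inj => /=; congr pair.
exists frac_ring, e, (build_rmorphism epsB epsM); split=> //.
- move=> u; have /choice[q /choice[q' hq]] := hfrac.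
  have /choice[w hw] : forall b, exists w, e (q' b) * w = 1.
    by move=> b; apply: e_unit; case: (hq b).
  have [N [c hc]] := @noetherian_mpoly A m noeA (q \o u).
  move: (w (u N)) (hw (u N)) => wN hwN.
  exists N, (fun i => e (c i) * e (q' (u i)) * wN).
  have -> : u N = e (q (u N)) * wN by rewrite -(hq _).2 -mulrA hwN mulr1.
  rewrite [q (u N)]hc rmorph_sum mulr_suml; apply: eq_bigr => i _.
  rewrite rmorphM -[e ((q \o u) i)](hq (u i)).2.
  by rewrite [u i * _]mulrC mulrA mulrAC.
- move=> a [[r F] hb] a0 h; have /asboolP[q [q' [hq' /= h1 h2]]] := hb.
  have F0 : F = 0.
    have /eqP : (tofrac (a%:MP : P)) * F = 0 by have := congr1 (snd \o val) h.
    by rewrite mulf_eq0 tofrac_eq0 mpolyC_eq0 (negbTE a0) => /eqP.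
  apply: val_inj; rewrite /= -[RHS]/(0, 0) F0.
  move: h2; rewrite F0 mul0r => /esym/eqP; rewrite tofrac_eq0 => /eqP q0.
  case: hq' => u hu; congr pair.
  by rewrite -[r]mulr1 -hu mulrA h1 q0 rmorph0 mul0r.
- split=> [q q' /(congr1 (snd \o val)) /= /eqP|r].
    by rewrite tofrac_eq => /eqP.
  have [q [q' [hq' h]]] := frac r; have [w hw] := e_unit _ hq'.
  exists (e q * w); rewrite -[LHS]/(eps (e q) * eps w).
  have : eps (e q' * w) = 1 by rewrite hw.
  rewrite -[LHS]/(ev q' * eps w) -[eps (e q)]/(ev q) -h -mulrA => ->.
  by rewrite mulr1.
Qed.

End LocalizedCover.

(** * Sections of presentations of smooth algebras *)

Section AdicSections.
Variables (A : comNzRingType) (R : comAlgType A) (B : comNzRingType).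
Variables (j : {rmorphism A -> B}) (eps : {rmorphism B -> R}).
Hypotheses (eps_j : forall a, eps (j a) = a%:A).
Hypothesis eps_surj : forall r, exists b, eps b = r.
Hypothesis smooth : formally_smooth R.

Definition rker : set B := [set b | eps b = 0].

Lemma rker_ideal : is_ideal rker.
Proof.
split=> [|x y hx hy|a x hx]; rewrite /rker /=; first exact: rmorph0.
  by rewrite rmorphD hx hy addr0.
by rewrite rmorphM hx mulr0.
Qed.
Hint Resolve rker_ideal : core.

(** Formal smoothness splits [B -> R] modulo every power of its kernel, one
    power at a time. *)
Lemma adic_section n : exists2 s : R -> B,
  hom_mod j (ideal_pow rker n.+1) s & forall r, eps (s r) = r.
Proof.
elim: n => [|n [s hs es]].
  have /choice[s hs] := eps_surj; exists s => //; rewrite ideal_pow1 //.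
  split=> [x y|x y|a]; rewrite /rker /=.
  - by rewrite rmorphB rmorphD !hs subrr.
  - by rewrite rmorphB rmorphM !hs subrr.
  - by rewrite rmorphB hs eps_j subrr.
have sub1 : ideal_pow rker n.+1 `<=` rker.
  by rewrite -[X in _ `<=` X]ideal_pow1 //; apply: ideal_pow_le.
have [||V hV e] := smooth_lift_mod smooth (ideal_pow_ideal _ n.+2)
    (ideal_pow_ideal _ n.+1) (@ideal_pow_subS _ _ _) _ _ hs.
- by move/sub1; rewrite /rker /= rmorph1 => /eqP; rewrite oner_eq0.
- move=> x y hx hy; apply: (ideal_pow_le _ (ideal_powD hx hy)).
  by rewrite addSn addnS !ltnS leq_addr.
exists V => // r; apply/subr0_eq; rewrite -[X in _ - X]es -rmorphB.
exact: (sub1 _ (e r)).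
Qed.

(** If [a x = 0], the sections send [x] to lifts [X_n] with [a X_n] in [J ^ n],
    [J] being the kernel.  The elements [a X_n t ^ n] of the Rees algebra of
    [J] satisfy a linear relation, by noetherianity; read in degree [N] and
    divided by [a] it expresses [X_N] by earlier terms with coefficients in
    positive powers of [J], so that [x = 0]. *)
Lemma smooth_regular (a : A) : noetherian B ->
  (forall b, j a * b = 0 -> b = 0) ->
  forall x : R, a%:A * x = 0 -> x = 0.
Proof.
move=> noeB reg x ax0; have [l lJ Jl] := noetherian_fg noeB rker_ideal.
have [N [f [noeN fC fX fP]]] :=
  noetherian_cover (@polyC B) [seq s *: 'X | s <- l] noeB.
have im1 b : rker b -> exists z, f z = b *: 'X.
  move=> /Jl; move: b; apply: gen_ideal_ind => [|s hs]; last first.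
    by apply: fX; apply: map_f.
  split=> [|u v [z ez] [z' ez']|c u [z ez]].
  - by exists 0; rewrite rmorph0 scale0r.
  - by exists (z + z'); rewrite rmorphD ez ez' scalerDl.
  - have [w ew] := fC c; exists (w * z).
    by rewrite rmorphM ez ew mul_polyC scalerA.
have im n : forall b, ideal_pow rker n b -> exists z, f z = b *: 'X^n.
  elim: n => [|n IH] b.
    by move=> _; have [z ez] := fC b; exists z; rewrite expr0 ez alg_polyC.
  move: b; apply: ideal_pow_ind => [|u v hu hv]; last first.
    have [z ez] := im1 _ hu; have [z' ez'] := IH _ hv; exists (z * z').
    by rewrite rmorphM ez ez' -scalerAl -scalerAr scalerA exprS.
  split=> [|u v [z ez] [z' ez']|c u [z ez]].
  - by exists 0; rewrite rmorph0 scale0r.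
  - by exists (z + z'); rewrite rmorphD ez ez' scalerDl.
  - have [w ew] := fC c; exists (w * z).
    by rewrite rmorphM ez ew mul_polyC scalerA.
have rees z k : ideal_pow rker k (f z)`_k.
  move: z k; apply: (fP [set F : {poly B} | forall k, ideal_pow rker k F`_k]) => /=.
  - by move=> F G hF hG k; rewrite coefD; apply: idealD.
  - move=> F G hF hG k; rewrite coefM; apply: ideal_sum => // i _.
    by rewrite -{1}(subnKC (ltn_ord i : (i <= k)%N)); apply: ideal_powD.
  - by move=> b [|k]; rewrite coefC //=; apply: ideal0.
  - move=> _ /mapP[s hs ->] k; rewrite coefZ coefX.
    case: eqP => [->|_]; last by rewrite mulr0; apply: ideal0.
    by rewrite mulr1 ideal_pow1 //; apply: lJ.
have /choice[s hs] : forall n, exists s : R -> B,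
    hom_mod j (ideal_pow rker n.+1) s /\ forall r, eps (s r) = r.
  by move=> n; have [s h1 h2] := adic_section n; exists s.
have /choice[z hz] : forall n, exists z, f z = (j a * s n x) *: 'X^(n.+1).
  move=> n; apply: im; have [hn _] := hs n.
  have e : s n (a *: x) = s n 0 by rewrite -mulr_algl ax0.
  apply: (ideal_subK _ (ideal_subC _ (hom_mod_scale _ hn a x))) => //.
  by rewrite e; apply: hom_mod0 hn.
have [M [c hc]] := noeN z.
have e : j a * s M x = j a * \sum_(i < M) (f (c i))`_(M - i) * s i x.
  have := congr1 (fun F : {poly B} => F`_M.+1) (hz M).
  rewrite hc rmorph_sum coef_sum coefZ coefXn eqxx mulr1 => <-.
  rewrite mulr_sumr; apply: eq_bigr => i _.
  rewrite rmorphM hz -scalerAr coefZ coefMXn ifF ?subSS; first by ring.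
  by apply/negbTE; rewrite -leqNgt ltnS ltnW.
have /subr0_eq eM : s M x - \sum_(i < M) (f (c i))`_(M - i) * s i x = 0.
  by apply: reg; rewrite mulrBr e subrr.
have [_ er] := hs M; rewrite -(er x) eM.
rewrite -[_ = 0]/(rker _); apply: ideal_sum => // i _; apply: ideal_mulr => //.
rewrite -[rker]ideal_pow1 //; apply: ideal_pow_le (rees _ _).
by rewrite subn_gt0.
Qed.

End AdicSections.

(** * Coefficient fields *)

Section AdjoinSubfield.
Variables (K : fieldType) (F : set K).

(** The proof is an argument, so that the predicate can be declared to be a
    subfield. *)
Definition subfield_pred of GRing.divring_closed (fun x => `[< F x >]) :
  {pred K} := fun x => `[< F x >].

Hypothesis hF : GRing.divring_closed (fun x => `[< F x >]).

HB.instance Definition _ :=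
  GRing.isDivringClosed.Build K (subfield_pred hF) hF.

Lemma adjoin_subfield (k : fieldType) (iota : {rmorphism k -> K}) (S : set K) :
  (forall c, F (iota c)) -> S `<=` F -> adjoin iota S `<=` F.
Proof.
move=> hk hS x /(_ (subfield_pred hF)) h; apply/asboolP; apply: h.
  by move=> c; apply/asboolP.
by move=> s Ss; apply/asboolP/hS.
Qed.
End AdjoinSubfield.

Lemma poly_taylor1 (R : comNzRingType) (g : {poly R}) (s v : R) :
  exists c, g.[s + v] = g.[s] + g^`().[s] * v + v ^+ 2 * c.
Proof.
elim/poly_ind: g => [|g a [c IH]].
  by exists 0; rewrite deriv0 !horner0 mul0r mulr0 !addr0.
exists (g^`().[s] + c * (s + v)); rewrite derivD derivC derivM derivX.
rewrite !hornerE IH; ring.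
Qed.

Section RenameVariables.
Variables (A S : comNzRingType) (f : {rmorphism A -> S}).

Definition rename n m (rho : 'I_n -> 'I_m) : {mpoly A[n]} -> {mpoly A[m]} :=
  mmap (@mpolyC m A) (fun i => 'X_(rho i)).

Lemma mmap_rename n m (rho : 'I_n -> 'I_m) (h : 'I_m -> S) q :
  mmap f h (rename rho q) = mmap f (h \o rho) q.
Proof.
elim/mpoly_ring_ind: q => [c|i|x y hx hy|x y hx hy].
- by rewrite /rename !mmapC.
- by rewrite /rename !mmapX !mmap1U mmapX mmap1U.
- by rewrite /rename !rmorphD /= -/(rename _ _) hx -/(rename _ _) hy.
- by rewrite /rename !rmorphM /= -/(rename _ _) hx -/(rename _ _) hy.
Qed.

(** Algebraic independence speaks of families without repetitions; renaming the
    variables of a polynomial along [rho] reduces to this case. *)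
Lemma injective_family n (K : eqType) (w : 'I_n -> K) (X : set K) :
  (forall i, X (w i)) ->
  exists m (v : 'I_m -> K) (rho : 'I_n -> 'I_m),
    [/\ injective v, forall i, X (v i) & w =1 v \o rho].
Proof.
move=> wX; pose l := undup (codom w).
have lt i : (index (w i) l < size l)%N by rewrite index_mem mem_undup codom_f.
exists (size l), (tnth (in_tuple l)), (fun i => Ordinal (lt i)); split.
- by apply/tuple_uniqP; apply: undup_uniq.
- move=> i; have : tnth (in_tuple l) i \in l by rewrite mem_tnth.
  by rewrite mem_undup => /codomP[i' ->].
- by move=> i; rewrite /= (tnth_nth (w i)) /= nth_index // mem_undup codom_f.
Qed.
End RenameVariables.

Section CoefficientField.
Variables (A RQ : comNzRingType) (jQ : {rmorphism A -> RQ}).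
Variables (k K : fieldType) (piA : {rmorphism A -> k}) (piQ : {rmorphism RQ -> K}).
Variables (iota : {rmorphism k -> K}) (I : set RQ).
Hypotheses (piA_surj : forall c, exists a, piA a = c)
  (piQ_surj : forall z, exists x, piQ x = z)
  (iota_piA : forall a, iota (piA a) = piQ (jQ a))
  (local : forall x, piQ x != 0 -> exists y, x * y = 1)
  (iI : is_ideal I) (I_ker : forall x, I x -> piQ x = 0)
  (I_sq : forall x y, piQ x = 0 -> piQ y = 0 -> I (x * y))
  (I_A : forall a, piA a = 0 -> I (jQ a)).

(** A subring containing [I] which meets the maximal ideal in [I] only: modulo
    [I], a subring that embeds in the residue field. *)
Definition coef_subring (G : set RQ) : Prop :=
  [/\ forall x y, G x -> G y -> G (x - y), forall x y, G x -> G y -> G (x * y),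
      I `<=` G, forall a, G (jQ a) & forall x, G x -> piQ x = 0 -> I x].

Section Polynomials.
Variables (G : set RQ) (hG : coef_subring G).

Lemma coef_subring1 : G 1.
Proof. by case: hG => _ _ _ h _; rewrite -(rmorph1 jQ). Qed.

Lemma coef_subring0 : G 0.
Proof. by case: hG => _ _ h _ _; apply: h; apply: ideal0. Qed.

Lemma coef_subringB x y : G x -> G y -> G (x - y).
Proof. by case: hG => h _ _ _ _; apply: h. Qed.

Lemma coef_subringM x y : G x -> G y -> G (x * y).
Proof. by case: hG => _ h _ _ _; apply: h. Qed.

Lemma coef_subringD x y : G x -> G y -> G (x + y).
Proof.
move=> Gx Gy; have -> : x + y = x - (0 - y) by rewrite sub0r opprK.
apply: coef_subringB => //; by apply: coef_subringB => //; apply: coef_subring0.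
Qed.

Lemma coef_subring_sum n (F : 'I_n -> RQ) :
  (forall i, G (F i)) -> G (\sum_(i < n) F i).
Proof.
move=> h; elim/big_ind: _ => //; [exact: coef_subring0 | exact: coef_subringD].
Qed.

Definition coefs_in (h : {poly RQ}) := forall i, G h`_i.

Lemma coefs_inM g h : coefs_in g -> coefs_in h -> coefs_in (g * h).
Proof.
move=> hg hh i; rewrite coefM; apply: coef_subring_sum => l.
exact: coef_subringM.
Qed.

End Polynomials.

(** Zorn's lemma, applied to the sets that form such a subring together with
    [G0], so that the empty chain is no exception. *)
Lemma coef_subring_max G0 : coef_subring G0 ->
  exists G, [/\ coef_subring G, G0 `<=` G
    & forall G', coef_subring G' -> G `<=` G' -> G' `<=` G].
Proof.
move=> hG0; pose P G := coef_subring (G `|` G0).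
have [F FP Ftot|G [PG Gmax]] := @Zorn_bigcup RQ P; last first.
  exists (G `|` G0); split=> // G' hG' sub; apply: contrapT => nsub.
  apply: (Gmax G'); last first.
    rewrite /P setUidl // => x G0x; apply: sub; exact: subsetUr.
  split; first by move=> x Gx; apply: sub; exact: subsetUl.
  by move=> sub'; apply: nsub => x /sub' Gx; left.
pose U := (\bigcup_(X in F) X) `|` G0.
have stage x y : U x -> U y ->
    exists X, [/\ coef_subring X, X x, X y & X `<=` U].
  move=> [[X FX Xx]|G0x] [[Y FY Yy]|G0y].
  - have [XY|YX] := Ftot X Y FX FY.
      exists (Y `|` G0); split; [exact: FP|by left; apply: XY|by left|].
      by move=> u [Yu|]; [left; exists Y|right].
    exists (X `|` G0); split; [exact: FP|by left|by left; apply: YX|].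
    by move=> u [Xu|]; [left; exists X|right].
  - exists (X `|` G0); split; [exact: FP|by left|by right|].
    by move=> u [Xu|]; [left; exists X|right].
  - exists (Y `|` G0); split; [exact: FP|by right|by left|].
    by move=> u [Yu|]; [left; exists Y|right].
  - by exists G0; split=> // u; right.
rewrite /P -/U; split.
- move=> x y Ux Uy; have [X [hX Xx Xy XU]] := stage x y Ux Uy.
  by apply: XU; apply: coef_subringB.
- move=> x y Ux Uy; have [X [hX Xx Xy XU]] := stage x y Ux Uy.
  by apply: XU; apply: coef_subringM.
- by case: hG0 => _ _ h _ _ x /h; right.
- by case: hG0 => _ _ _ h _ a; right.
- move=> x Ux; have [X [hX Xx _ _]] := stage x x Ux Ux.
  by case: hX => _ _ _ _; apply.
Qed.

Section Maximal.
Variables (G : set RQ) (hG : coef_subring G).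
Hypothesis Gmax : forall G', coef_subring G' -> G `<=` G' -> G' `<=` G.

Lemma coef_ker x : G x -> piQ x = 0 -> I x.
Proof. by case: hG => _ _ _ _; apply. Qed.

(** A maximal such subring is closed under fractions, hence its image in the
    residue field is a subfield. *)
Lemma coef_fraction d x : G d -> piQ d != 0 -> G (d * x) -> G x.
Proof.
move=> Gd d0 Gdx.
apply: (Gmax (G' := [set x | exists e, [/\ G e, piQ e != 0 & G (e * x)]]));
  last by exists d.
- split.
  + move=> u v [e [Ge e0 Geu]] [e' [Ge' e'0 Gev]]; exists (e * e'); split.
    * exact: coef_subringM.
    * by rewrite rmorphM mulf_neq0.
    * have -> : e * e' * (u - v) = e' * (e * u) - e * (e' * v) by ring.
      by apply: coef_subringB => //; apply: coef_subringM.
  + move=> u v [e [Ge e0 Geu]] [e' [Ge' e'0 Gev]]; exists (e * e'); split.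
    * exact: coef_subringM.
    * by rewrite rmorphM mulf_neq0.
    * by rewrite mulrACA; apply: coef_subringM.
  + move=> u Iu; exists 1; rewrite mul1r rmorph1 oner_eq0; split=> //.
      exact: coef_subring1.
    by case: hG => _ _ h _ _; apply: h.
  + move=> a; exists 1; rewrite mul1r rmorph1 oner_eq0; split=> //.
      exact: coef_subring1.
    by case: hG => _ _ _ h _.
  + move=> u [e [Ge e0 Geu]] u0; have [y hy] := local e0.
    rewrite -[u]mul1r -hy mulrAC; apply: ideal_mulr => //.
    by apply: coef_ker; rewrite // rmorphM u0 mulr0.
- move=> u Gu; exists 1; rewrite mul1r rmorph1 oner_eq0; split=> //.
  exact: coef_subring1.
Qed.

Lemma coef_inv d : G d -> piQ d != 0 -> exists2 e, G e & d * e = 1.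
Proof.
move=> Gd d0; have [e he] := local d0; exists e => //.
by apply: (coef_fraction Gd d0); rewrite he; apply: coef_subring1.
Qed.

Definition coef_image : set K := [set z | exists2 g, G g & piQ g = z].

Lemma coef_image_divring : GRing.divring_closed (fun x => `[< coef_image x >]).
Proof.
split.
- by apply/asboolP; exists 1; [apply: coef_subring1 | rewrite rmorph1].
- move=> x y /asboolP[g Gg <-] /asboolP[h Gh <-]; apply/asboolP.
  by exists (g - h); [apply: coef_subringB | rewrite rmorphB].
- move=> x y /asboolP[g Gg <-] /asboolP[h Gh <-]; apply/asboolP.
  have [h0|h0] := eqVneq (piQ h) 0.
    exists 0; first exact: coef_subring0.
    by rewrite rmorph0 h0 invr0 mulr0.
  have [e Ge he] := coef_inv Gh h0.
  exists (g * e); first exact: coef_subringM.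
  rewrite rmorphM; congr (_ * _); apply: (mulfI h0).
  by rewrite -rmorphM he rmorph1 mulfV.
Qed.

Lemma coef_image_adjoin (X : set K) :
  X `<=` coef_image -> adjoin iota X `<=` coef_image.
Proof.
apply: adjoin_subfield; first exact: coef_image_divring.
move=> c; have [a <-] := piA_surj c; exists (jQ a); last by rewrite iota_piA.
by case: hG => _ _ _ h _.
Qed.

Section SeparableElement.
Variables (z : K) (f : {poly K}).
Hypotheses (f_monic : f \is monic) (f_coef : forall i, coef_image f`_i).
Hypotheses (f_root : root f z) (f_sep : separable_poly f).

Local Notation red := (map_poly piQ).

Lemma coef_red (h : {poly RQ}) i : (red h)`_i = piQ h`_i.
Proof. exact: coef_map. Qed.

Lemma coef_poly_lift : exists h : {poly RQ},
  [/\ coefs_in G h, h \is monic & red h = f].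
Proof.
have /choice[c hc] : forall i, exists g, G g /\ piQ g = f`_i.
  by move=> i; have [g Gg e] := f_coef i; exists g.
have f_gt0 : (0 < size f)%N by rewrite size_poly_gt0 monic_neq0.
pose E i := if i == (size f).-1 then 1 else c i.
have sz : size (\poly_(i < size f) E i) = size f.
  by apply: size_poly_eq; rewrite /E eqxx oner_eq0.
exists (\poly_(i < size f) E i); split.
- move=> i; rewrite coef_poly /E; case: ifP => _; last exact: coef_subring0.
  by case: eqP => _; [apply: coef_subring1 | case: (hc i)].
- by rewrite monicE /lead_coef sz coef_poly prednK // leqnn /E eqxx.
- apply/polyP => i; rewrite coef_red coef_poly /E.
  case: ltnP => [lt_i|le_i]; last by rewrite rmorph0 nth_default.
  case: eqP => [->|_]; last by case: (hc i).
  by rewrite rmorph1; apply/esym/eqP; rewrite -[_ == _]monicE.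
Qed.

(** A monic polynomial over [G] of least degree that vanishes at [z] modulo
    the maximal ideal lifts the minimal polynomial of [z].  Division by it is
    carried out over [G], up to coefficients in [I]. *)
Lemma coef_min_poly : exists g : {poly RQ},
  [/\ coefs_in G g, g \is monic, root (red g) z
    & forall h, coefs_in G h -> root (red h) z ->
        exists q r, h = q * g + r /\ forall i, I r`_i].
Proof.
pose good n := exists g : {poly RQ},
  [/\ coefs_in G g, g \is monic, root (red g) z & size g = n].
have : exists n, `[< good n >].
  have [h [Gh hm e]] := coef_poly_lift; exists (size h); apply/asboolP.
  by exists h; split; rewrite ?e.
case/ex_minnP => _ /asboolP[g [Gg gm gz <-]] gmin; exists g; split=> // h.
have [n] := ubnP (size h); elim: n h => // n IH h; rewrite ltnS => le_hn Gh hz.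
have [lt_hg|le_gh] := ltnP (size h) (size g).
  exists 0, h; split=> [|i]; first by rewrite mul0r add0r.
  have [h0|h0] := eqVneq (red h) 0.
    by apply: coef_ker => //; rewrite -coef_red h0 coef0.
  exfalso; have e_gt0 : (0 < size (red h))%N by rewrite size_poly_gt0.
  pose c := h`_(size (red h)).-1.
  have c0 : piQ c != 0 by rewrite /c -coef_red -/(lead_coef _) lead_coef_eq0.
  have [d Gd cd] := coef_inv (Gh _) c0.
  pose g1 := \poly_(i < size (red h)) (d * h`_i).
  have lead1 : d * h`_(size (red h)).-1 = 1 by rewrite mulrC.
  have sz : size g1 = size (red h).
    by apply: size_poly_eq; rewrite lead1 oner_eq0.
  have : (size g <= size (red h))%N.
    apply: gmin; apply/asboolP; exists g1; split=> //.
    - move=> j; rewrite coef_poly; case: ifP => _; last exact: coef_subring0.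
      exact: coef_subringM.
    - by rewrite monicE /lead_coef sz coef_poly prednK // leqnn lead1.
    - have -> : red g1 = piQ d *: red h.
        apply/polyP => j; rewrite coef_red coef_poly coefZ coef_red.
        case: ltnP => [_|le_j]; first by rewrite rmorphM.
        by rewrite rmorph0 -coef_red nth_default ?mulr0.
      by rewrite /root hornerZ mulf_eq0; apply/orP; right.
  rewrite leqNgt => /negP; apply; apply: leq_ltn_trans lt_hg.
  exact: size_poly.
have h_neq0 : h != 0.
  rewrite -size_poly_gt0; apply: leq_trans le_gh.
  by rewrite size_poly_gt0 monic_neq0.
pose s := lead_coef h *: (g * 'X^(size h - size g)).
have s_coef : coefs_in G s.
  move=> i; rewrite coefZ coefMXn; apply: coef_subringM => //; first exact: Gh.
  by case: ifP => _ //; apply: coef_subring0.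
have g_gt0 : (0 < size g)%N by rewrite size_poly_gt0 monic_neq0.
have lt_hs : (size (h - s)%R < size h)%N.
  apply: size_lead_cancel => //.
    apply: (leq_trans (size_scale_leq _ _)).
    by rewrite size_mulXn ?monic_neq0 // subnK.
  rewrite coefZ coefMXn ifF; last by apply/negbTE; lia.
  have -> : ((size h).-1 - (size h - size g))%N = (size g).-1 by lia.
  by rewrite -/(lead_coef g) (eqP gm) mulr1.
have [|i||q [r [e hr]]] := IH (h - s).
- exact: leq_trans lt_hs le_hn.
- by rewrite coefB; apply: coef_subringB.
- rewrite /root rmorphB hornerD hornerN (eqP hz) sub0r oppr_eq0.
  by rewrite /s /= map_polyZ rmorphM /= hornerZ hornerM (eqP gz) mul0r mulr0.
exists (q + lead_coef h *: 'X^(size h - size g)), r; split=> //.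
by rewrite mulrDl -scalerAl ['X^_ * g]mulrC -/s addrAC -e subrK.
Qed.

(** A separable element lifts to an element [t] over which [G] can be enlarged
    by adjunction: one Newton step makes the lifted minimal polynomial vanish
    at [t] modulo [I], since squares of the maximal ideal lie in [I]. *)
Lemma separable_lift : exists2 t, G t & piQ t = z.
Proof.
have [g [Gg gm gz gdiv]] := coef_min_poly.
have [fl [Gfl flm efl]] := coef_poly_lift.
have g'z : (red g)^`().[z] != 0.
  have [|q [r [e hr]]] := gdiv fl Gfl; first by rewrite efl.
  have er : red r = 0.
    by apply/polyP => i; rewrite coef_red coef0; apply/I_ker/hr.
  have ef : f = red q * red g by rewrite -efl e rmorphD rmorphM /= er addr0.
  have : f^`().[z] != 0.
    by move: f_sep; rewrite separable_poly.unlock => /coprimep_root; apply.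
  apply: contra => /eqP g'0.
  by rewrite ef derivM hornerD !hornerM (eqP gz) g'0 !mulr0 addr0.
have [s hs] := piQ_surj z.
have pi_horner (h : {poly RQ}) x : piQ h.[x] = (red h).[piQ x].
  by rewrite horner_map.
have [w hw] : exists w, g^`().[s] * w = 1.
  by apply: local; rewrite pi_horner hs -deriv_map.
pose v := - (g.[s] * w); have v0 : piQ v = 0.
  by rewrite rmorphN rmorphM pi_horner hs (eqP gz) mul0r oppr0.
have gt : I g.[s + v].
  have [c ->] := poly_taylor1 g s v.
  have -> : g.[s] + g^`().[s] * v + v ^+ 2 * c
      = g.[s] * (1 - g^`().[s] * w) + v * v * c by rewrite /v; ring.
  rewrite hw subrr mulr0 add0r; apply: ideal_mulr => //; exact: I_sq.
set t := s + v in gt; have et : piQ t = z by rewrite rmorphD hs v0 addr0.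
have key h : coefs_in G h -> piQ h.[t] = 0 -> I h.[t].
  move=> Gh; rewrite pi_horner et => h0.
  have [|q [r [-> hr]]] := gdiv h Gh; first exact/eqP.
  rewrite hornerD hornerM; apply: idealD => //; first exact: ideal_mull.
  by rewrite horner_coef; apply: ideal_sum => // i _; apply: ideal_mulr.
exists t => //.
apply: (Gmax (G' := [set x | exists2 h, coefs_in G h & x = h.[t]])).
- split.
  + move=> _ _ [h Gh ->] [h' Gh' ->]; exists (h - h'); last by rewrite !hornerE.
    by move=> i; rewrite coefB; apply: coef_subringB.
  + move=> _ _ [h Gh ->] [h' Gh' ->]; exists (h * h'); last by rewrite hornerM.
    exact: coefs_inM.
  + move=> x Ix; exists x%:P; last by rewrite hornerC.
    move=> i; rewrite coefC; case: eqP => _; last exact: coef_subring0.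
    by case: hG => _ _ h _ _; apply: h.
  + move=> a; exists (jQ a)%:P; last by rewrite hornerC.
    move=> i; rewrite coefC; case: eqP => _; last exact: coef_subring0.
    by case: hG => _ _ _ h _.
  + by move=> _ [h Gh ->]; apply: key.
- move=> x Gx; exists x%:P; last by rewrite hornerC.
  by move=> i; rewrite coefC; case: eqP => _ //; apply: coef_subring0.
- exists 'X; last by rewrite hornerX.
  move=> i; rewrite coefX; case: eqP => _; last exact: coef_subring0.
  exact: coef_subring1.
Qed.

End SeparableElement.
End Maximal.
Section TranscendenceBasis.
Variables (X : set K) (X_ind : alg_independent iota X).
Variables (lift : K -> RQ) (lift_pi : forall z, piQ (lift z) = z).

Definition poly_in_lifts : set RQ :=
  [set x | exists n (v : 'I_n -> K) (q : {mpoly A[n]}),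
     (forall i, X (v i)) /\ I (x - mmap jQ (lift \o v) q)].

Lemma poly_in_lifts_common x y : poly_in_lifts x -> poly_in_lifts y ->
  exists n (v : 'I_n -> K) (q q' : {mpoly A[n]}),
    [/\ forall i, X (v i), I (x - mmap jQ (lift \o v) q)
      & I (y - mmap jQ (lift \o v) q')].
Proof.
move=> [n [v [q [vX hx]]]] [n' [v' [q' [v'X hy]]]].
pose w (i : 'I_(n + n')) := match split i with inl a => v a | inr b => v' b end.
exists (n + n')%N, w, (rename (@lshift n n') q), (rename (@rshift n n') q').
split; first by move=> i; rewrite /w; case: (split i).
  rewrite mmap_rename.
  suff <- : lift \o v = (lift \o w) \o @lshift n n' by [].
  apply/funext => i /=; rewrite /w.
  by rewrite -[lshift _ _]/(unsplit (inl i)) unsplitK.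
rewrite mmap_rename.
suff <- : lift \o v' = (lift \o w) \o @rshift n n' by [].
apply/funext => i /=; rewrite /w.
by rewrite -[rshift _ _]/(unsplit (inr i)) unsplitK.
Qed.

Lemma mmap_ideal n (h : 'I_n -> RQ) (q : {mpoly A[n]}) :
  (forall m, I (jQ q@_m)) -> I (mmap jQ h q).
Proof. by move=> hq; apply: ideal_sum => // m _; apply: ideal_mulr. Qed.

(** Any lift of a transcendence basis will do: a polynomial in the lifts lies in
    the maximal ideal only if its coefficients vanish in [k]. *)
Lemma poly_in_lifts_coef : coef_subring poly_in_lifts.
Proof.
split.
- move=> x y hx hy; have [n [v [q [q' [vX hq hq']]]]] := poly_in_lifts_common hx hy.
  exists n, v, (q - q'); split=> //; rewrite rmorphB /= opprD addrACA -opprD.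
  exact: idealB.
- move=> x y hx hy; have [n [v [q [q' [vX hq hq']]]]] := poly_in_lifts_common hx hy.
  exists n, v, (q * q'); split=> //; rewrite rmorphM /=.
  exact: ideal_mul_congr.
- move=> x Ix; exists 0%N, (fun=> 0), 0; split; first by case.
  by rewrite rmorph0 subr0.
- move=> a; exists 0%N, (fun=> 0), a%:MP; split; first by case.
  by rewrite mmapC subrr; apply: ideal0.
- move=> x [n [w [q [wX hq]]]] x0.
  have [m [v [rho [v_inj vX ew]]]] := injective_family wX.
  have e : mmap jQ (lift \o w) q = mmap jQ (lift \o v) (rename rho q).
    by rewrite mmap_rename; congr mmap; apply/funext => i; rewrite /= ew.
  rewrite e in hq; move: (rename rho q) hq => {e} p hp.
  apply: (ideal_subK iI hp); apply: mmap_ideal => mon; apply: I_A.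
  rewrite -(mcoeff_map_mpoly piA) [map_mpoly _ _](X_ind v_inj vX) ?mcoeff0 //.
  have /I_ker := hp; rewrite rmorphB x0 sub0r => /eqP; rewrite oppr_eq0 => /eqP <-.
  elim/mpoly_ring_ind: p {hp} => [c|i|u u' hu hu'|u u' hu hu'].
  + by rewrite map_mpolyC !mmapC; apply: iota_piA.
  + by rewrite map_mpolyX !mmapX !mmap1U /= lift_pi.
  + by rewrite !rmorphD /= hu hu'.
  + by rewrite !rmorphM /= hu hu'.
Qed.

End TranscendenceBasis.

(** Cohen's structure theorem, modulo [I]: when the residue field is separable,
    some subring is mapped isomorphically to it, up to [I].  One takes a maximal
    subring as above that contains lifts of a separating transcendence basis.
    Here [tau] is the resulting retraction, seen as a map from [RQ] to itself. *)
Lemma coefficient_field (L : set K) :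
  (forall z, L z) -> separably_generated iota L ->
  exists tau : RQ -> RQ,
    [/\ forall x, piQ (tau x) = piQ x,
        forall x y, I (tau (x + y) - (tau x + tau y)),
        forall x y, I (tau (x * y) - tau x * tau y),
        forall a, I (tau (jQ a) - jQ a)
      & forall x, piQ x = 0 -> I (tau x)].
Proof.
move=> Lall [X [_ X_ind Xsep]]; have /choice[lift lift_pi] := piQ_surj.
have hG0 := poly_in_lifts_coef X_ind lift_pi.
have [G [hG G0G Gmax]] := coef_subring_max hG0.
have X_im : X `<=` coef_image G.
  move=> z Xz; exists (lift z); rewrite ?lift_pi //; apply: G0G.
  exists 1%N, (fun=> z), 'X_ord0; split=> //.
  by rewrite mmapX mmap1U /= subrr; apply: ideal0.
have onto z : exists g, G g /\ piQ g = z.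
  have [f [fm fX fz _] fsep] := Xsep z (Lall z).
  have [|g Gg gz] := separable_lift hG Gmax fm _ fz fsep; last by exists g.
  by move=> i; apply: (coef_image_adjoin hG Gmax X_im).
have /choice[t ht] := onto.
have Gt x : G (t x) by case: (ht x).
have tE x : piQ (t x) = x by case: (ht x).
have ker x : G x -> piQ x = 0 -> I x by case: hG => _ _ _ _; apply.
exists (t \o piQ); split=> [x|x y|x y|a|x x0] /=; first exact: tE.
- apply: ker; first by apply: coef_subringB => //; apply: coef_subringD.
  by rewrite rmorphB !rmorphD !tE subrr.
- apply: ker; first by apply: coef_subringB => //; apply: coef_subringM.
  by rewrite rmorphB !rmorphM !tE subrr.
- apply: ker; last by rewrite rmorphB tE subrr.
  by apply: coef_subringB => //; case: hG.
- by apply: ker => //; rewrite tE.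
Qed.

End CoefficientField.
(** * Taylor expansions and differential operators *)

Section Filtration.
Variables (R : comNzRingType) (m : nat).
Local Notation S := {mpoly R[m]}.

(** The powers of the ideal generated by the variables. *)
Definition var_pow c : set S :=
  [set F | all (fun a => c <= mdeg a)%N (msupp F)].

Lemma var_powP c F :
  var_pow c F <-> forall a, (mdeg a < c)%N -> F@_a = 0.
Proof.
split=> [/allP h a ha|h].
  by apply: memN_msupp_eq0; apply/negP => /h; rewrite leqNgt ha.
apply/allP => a; rewrite mcoeff_msupp leqNgt; apply: contraNN => ha.
by rewrite h.
Qed.

Lemma var_powM c d (F G : S) :
  var_pow c F -> var_pow d G -> var_pow (c + d) (F * G).
Proof.
move=> /var_powP hF /var_powP hG; apply/var_powP => a ha.
rewrite mcoeffM big1 // => -[[x hx] [y hy]] /= /eqP/(congr1 mdeg).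
rewrite mdegD => e.
have [lt_c|le_c] := ltnP (mdeg x) c; first by rewrite hF ?mul0r.
rewrite (hG y) ?mulr0 // -(ltn_add2l c); apply: leq_ltn_trans ha.
by rewrite e leq_add2r.
Qed.

Lemma var_pow0 F : var_pow 0 F. Proof. exact/var_powP. Qed.

Lemma var_pow_ideal c : is_ideal (var_pow c).
Proof.
split=> [|F G /var_powP hF /var_powP hG|F G hG].
- by apply/var_powP => a _; rewrite mcoeff0.
- by apply/var_powP => a ha; rewrite mcoeffD hF // hG // addr0.
- by rewrite -[c]add0n; apply: var_powM => //; apply: var_pow0.
Qed.
Hint Resolve var_pow_ideal : core.

Lemma var_pow_le c d : (c <= d)%N -> var_pow d `<=` var_pow c.
Proof.
by move=> cd F /var_powP hF; apply/var_powP => a ha; apply: hF; apply: leq_trans cd.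
Qed.

Lemma var_powX i : var_pow 1 'X_i.
Proof.
apply/var_powP => a; rewrite ltnS leqn0 mdeg_eq0 => /eqP->; rewrite mcoeffX.
by rewrite -mdeg_eq0 mdeg1.
Qed.

(** Inversion of a formal power series with invertible constant term. *)
Lemma var_pow_inv (F : S) c u M :
  var_pow 1 (F - c%:MP) -> c * u = 1 -> exists G, var_pow M (F * G - 1).
Proof.
move=> hF cu; elim: M => [|M [G hG]]; first by exists 0; apply: var_pow0.
exists (G - (F * G - 1) * u%:MP).
have -> : F * (G - (F * G - 1) * u%:MP) - 1
        = (F * G - 1) * (1 - c%:MP * u%:MP - u%:MP * (F - c%:MP)) by ring.
rewrite -mpolyCM cu mpolyC1 subrr sub0r -addn1; apply: var_powM => //.
by apply: idealN => //; apply: ideal_mull.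
Qed.

Lemma var_pow_cancel (F G : S) c u M :
  var_pow 1 (F - c%:MP) -> c * u = 1 -> var_pow M (G * F) -> var_pow M G.
Proof.
move=> hF cu h; have [H hH] := var_pow_inv M hF cu.
have -> : G = G * F * H - (F * H - 1) * G by ring.
by apply: idealB => //; apply: ideal_mulr.
Qed.

End Filtration.
#[local] Hint Resolve var_pow_ideal : core.

Section TaylorMorphism.
Variables (A : idomainType) (R : comAlgType A) (m : nat).
Variables (ev : {rmorphism {mpoly A[m]} -> R}).
Hypothesis evC : forall a, ev a%:MP = a%:A.
Local Notation S := {mpoly R[m]}.

(** The expansion [q |-> q (y + X)] of polynomials around the generators [y]
    of [R]. *)
Definition taylor : {mpoly A[m]} -> S :=
  mmap (@mpolyC m R \o in_alg R) (fun i => (ev 'X_i)%:MP + 'X_i).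

HB.instance Definition _ := GRing.RMorphism.on taylor.

Lemma taylorC a : taylor a%:MP = (a%:A)%:MP.
Proof. by rewrite /taylor mmapC. Qed.

Lemma taylorX i : taylor 'X_i = (ev 'X_i)%:MP + 'X_i.
Proof. by rewrite /taylor mmapX mmap1U. Qed.

Lemma taylor_ev q : var_pow 1 (taylor q - (ev q)%:MP).
Proof.
elim/mpoly_ring_ind: q => [a|i|q q' hq hq'|q q' hq hq'].
- by rewrite taylorC evC subrr; apply: ideal0.
- by rewrite taylorX addrC addKr; apply: var_powX.
- by rewrite !rmorphD; apply: ideal_add_congr.
- by rewrite !rmorphM; apply: ideal_mul_congr.
Qed.

Hypothesis smooth : formally_smooth R.
Hypothesis frac : forall r, exists q q', (exists u, ev q' * u = 1) /\
  r * ev q' = ev q.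
Hypothesis noeA : noetherian A.

Lemma regular_scalar (a : A) : a != 0 -> forall x : R, a%:A * x = 0 -> x = 0.
Proof.
move=> a0; have [B [e [eps [noeB reg eps_e [_ eps_surj] _]]]] :=
  localized_cover noeA frac.
have eps_j b : eps ((e \o @mpolyC m A) b) = b%:A by rewrite /= eps_e evC.
apply: (smooth_regular eps_j eps_surj smooth noeB) => b /=.
exact: reg.
Qed.

(** The Taylor expansion of [R] itself, to any finite order: it extends from
    polynomials to fractions, and is transported to [R] by a section of its
    presentation. *)
Lemma smooth_taylor N : exists V : R -> S,
  [/\ hom_mod (fun a : A => (a%:A)%:MP) (var_pow N.+1) V,
      forall r, var_pow 1 (V r - r%:MP)
    & forall r, exists q q', [/\ exists u, ev q' * u = 1, r * ev q' = ev q
        & var_pow N.+1 (V r * taylor q' - taylor q)]].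
Proof.
have [B [e [eps [_ _ eps_e [e_inj eps_surj] hfrac]]]] := localized_cover noeA frac.
pose I : set S := var_pow N.+1; have iI : is_ideal I := var_pow_ideal R m N.+1.
have cancel q (F : S) : (exists u, ev q * u = 1) -> I (F * taylor q) -> I F.
  by case=> u hu; apply: var_pow_cancel hu; apply: taylor_ev.
have : forall b : B, exists F : S, forall q q', (exists u, ev q' * u = 1) ->
    b * e q' = e q -> I (F * taylor q' - taylor q).
  move=> b; have [q0 [q0' [[u0 hu0] h0]]] := hfrac b.
  have [G hG] := var_pow_inv N.+1 (taylor_ev q0') hu0.
  exists (taylor q0 * G) => q q' hq' h.
  have ee : q0 * q' = q * q0'.
    by apply: e_inj; rewrite !rmorphM -h0 -h; ring.
  apply: (cancel q0'); first by exists u0.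
  have -> : (taylor q0 * G * taylor q' - taylor q) * taylor q0'
    = taylor (q0 * q') * (taylor q0' * G) - taylor (q * q0').
    by rewrite !rmorphM; ring.
  have -> : taylor (q0 * q') * (taylor q0' * G) - taylor (q * q0')
    = taylor (q * q0') * (taylor q0' * G - 1) by rewrite ee; ring.
  exact: ideal_mull.
move=> /choice[th hth].
have thD b c : I (th (b + c) - (th b + th c)).
  have [q [q' [hq' h]]] := hfrac b; have [s [s' [hs' k]]] := hfrac c.
  apply: (cancel q') => //; apply: (cancel s') => //.
  have hqs : exists u, ev (q' * s') * u = 1.
    have [[u hu] [v hv]] := (hq', hs').
    by exists (u * v); rewrite rmorphM mulrACA hu hv mulr1.
  have h3 : (b + c) * e (q' * s') = e (q * s' + s * q').
    by rewrite rmorphD !rmorphM -h -k; ring.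
  have i1 := hth _ _ _ hq' h; have i2 := hth _ _ _ hs' k.
  have i3 := hth _ _ _ hqs h3; rewrite rmorphD !rmorphM in i3.
  have -> : (th (b + c) - (th b + th c)) * taylor q' * taylor s'
    = (th (b + c) * (taylor q' * taylor s')
        - (taylor q * taylor s' + taylor s * taylor q'))
      - (th b * taylor q' - taylor q) * taylor s'
      - (th c * taylor s' - taylor s) * taylor q' by ring.
  by apply: idealB; [|apply: idealB|] => //; apply: ideal_mulr.
have thM b c : I (th (b * c) - th b * th c).
  have [q [q' [hq' h]]] := hfrac b; have [s [s' [hs' k]]] := hfrac c.
  apply: (cancel q') => //; apply: (cancel s') => //.
  have hqs : exists u, ev (q' * s') * u = 1.
    have [[u hu] [v hv]] := (hq', hs').
    by exists (u * v); rewrite rmorphM mulrACA hu hv mulr1.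
  have h3 : (b * c) * e (q' * s') = e (q * s).
    by rewrite !rmorphM -h -k; ring.
  have i1 := hth _ _ _ hq' h; have i2 := hth _ _ _ hs' k.
  have i3 := hth _ _ _ hqs h3; rewrite !rmorphM in i3.
  have -> : (th (b * c) - th b * th c) * taylor q' * taylor s'
    = (th (b * c) * (taylor q' * taylor s') - taylor q * taylor s)
      - (th b * taylor q' - taylor q) * (th c * taylor s')
      - (th c * taylor s' - taylor s) * taylor q by ring.
  by apply: idealB; [|apply: idealB|] => //; apply: ideal_mulr.
have th1 a : I (th (e a%:MP) - (a%:A)%:MP).
  have h : e a%:MP * e 1 = e a%:MP by rewrite rmorph1 mulr1.
  have u1 : exists u, ev 1 * u = 1 by exists 1; rewrite rmorph1 mulr1.
  by have := hth _ _ _ u1 h; rewrite rmorph1 mulr1 taylorC.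
have th_eps b : var_pow 1 (th b - (eps b)%:MP).
  have [q [q' [[u hu] h]]] := hfrac b.
  have hq' : exists u, ev q' * u = 1 by exists u.
  apply: (var_pow_cancel (taylor_ev q') hu).
  have -> : (th b - (eps b)%:MP) * taylor q' = (th b * taylor q' - taylor q)
    + (taylor q - (ev q)%:MP) - (eps b)%:MP * (taylor q' - (ev q')%:MP).
    by rewrite -!eps_e -h rmorphM mpolyCM; ring.
  apply: idealB => //; last by apply: ideal_mull => //; apply: taylor_ev.
  apply: idealD => //; last exact: taylor_ev.
  by apply: (var_pow_le _ (hth _ _ _ hq' h)).
have thJ n b : (n <= N.+1)%N -> ideal_pow (rker eps) n b -> var_pow n (th b).
  elim: n b => [|n IH] b le_n; first by move=> _; apply: var_pow0.
  move: b; apply: (ideal_pow_ind_add (P := [set b | var_pow n.+1 (th b)])) => /= [|b c hb hc|b c hb hc].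
  - have := thD 0 0; rewrite addr0 opprD addrA subrr sub0r => /(idealN (var_pow_ideal _ _ _)).
    by rewrite opprK; apply: var_pow_le.
  - apply: (ideal_subK (var_pow_ideal _ _ _) (var_pow_le le_n (thD b c))).
    exact: idealD.
  - apply: (ideal_subK (var_pow_ideal _ _ _) (var_pow_le le_n (thM b c))).
    rewrite -add1n; apply: var_powM; last by apply: IH => //; apply: ltnW.
    by have := th_eps b; rewrite hb mpolyC0 subr0.
have eps_j a : eps ((e \o @mpolyC m A) a) = a%:A by rewrite /= eps_e evC.
have [s [sD sM sA] es] := adic_section eps_j eps_surj smooth N.
have th_congr b c : ideal_pow (rker eps) N.+1 (b - c) -> I (th b - th c).
  move=> h; have := thD (b - c) c; rewrite subrK => h'.
  have -> : th b - th c = (th b - (th (b - c) + th c)) + th (b - c) by ring.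
  by apply: idealD => //; apply: thJ.
exists (th \o s); split=> [|r|r].
- split=> [x y|x y|a] /=.
  + exact: (ideal_trans iI (th_congr _ _ (sD x y)) (thD _ _)).
  + exact: (ideal_trans iI (th_congr _ _ (sM x y)) (thM _ _)).
  + exact: (ideal_trans iI (th_congr _ _ (sA a)) (th1 _)).
- by rewrite /= -[X in X%:MP]es.
- have [q [q' [hq' h]]] := hfrac (s r); exists q, q'; split=> //.
    by rewrite -!eps_e -h rmorphM es.
  exact: hth.
Qed.

(** The commutator with multiplication by [b] replaces [W] by
    [W * (V b - b)], whose order is larger by one. *)
Lemma taylor_diffop N (V : R -> S) (W : S) c t a :
  hom_mod (fun a : A => (a%:A)%:MP) (var_pow N.+1) V ->
  (forall r, var_pow 1 (V r - r%:MP)) ->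
  var_pow c W -> mdeg a = (c + t)%N -> (mdeg a <= N)%N ->
  @diffop A R t (fun r => (W * V r)@_a).
Proof.
move=> hV V1; elim: t c W => [|t IH] c W hW ha le_aN.
  exists W@_a; apply/funext => r.
  have -> : W * V r = W * (V r - r%:MP) + r%:MP * W by ring.
  rewrite mcoeffD mcoeffCM ((var_powP _ _).1 (var_powM hW (V1 r))) ?add0r 1?mulrC //.
  by rewrite ha addn0 addn1.
have [hD hM hA] := hV.
have coef0 F : var_pow N.+1 F -> (W * F)@_a = 0.
  move=> hF; have /var_powP -> // := ideal_mull W (var_pow_ideal _ _ _) hF.
split=> [b x y|_ [b ->]].
  pose j : {rmorphism A -> S} := (@mpolyC m R \o in_alg R)%FUN.
  have hVj : hom_mod j (var_pow N.+1) V by [].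
  have hd : var_pow N.+1 (V (b *: x + y) - ((b%:A)%:MP * V x + V y)).
    apply: (ideal_trans _ (hD _ _)) => //; apply: ideal_add_congr => //.
      exact: (hom_mod_scale _ hVj).
    by rewrite subrr; apply: ideal0.
  have -> : W * V (b *: x + y) = W * (V (b *: x + y) - ((b%:A)%:MP * V x + V y))
     + ((b%:A)%:MP * (W * V x) + W * V y) by ring.
  by rewrite !mcoeffD mcoeffCM coef0 // add0r mulr_algl.
have -> : (fun x => (W * V (b * x))@_a - b * (W * V x)@_a)
        = (fun x => (W * (V b - b%:MP) * V x)@_a).
  apply/funext => x; rewrite -mcoeffCM -mcoeffB.
  have -> : W * V (b * x) - b%:MP * (W * V x)
    = W * (V (b * x) - V b * V x) + W * (V b - b%:MP) * V x by ring.
  by rewrite mcoeffD coef0 ?add0r.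
apply: (IH c.+1); rewrite ?ha ?addnS //; last by rewrite -addnS -ha.
by rewrite -addn1; apply: var_powM.
Qed.

End TaylorMorphism.
(** * Leading forms *)

Section LeadingForms.
Variables (A : idomainType) (R : comAlgType A) (Q : prime_idealr R).
Variables (RQ : comNzRingType) (loc : {rmorphism R -> RQ}).
Hypothesis hloc : is_localization_at Q loc.
Variables (p : nat) (pQ : p%:R \in Q).
Local Notation M := (loc_pow Q loc).

Lemma loc_pow_nat : M 1 p%:R.
Proof. by rewrite -(rmorph_nat loc); apply/(loc_pow_symb hloc); rewrite symb1. Qed.

(** The ideal [p M_(b-1) + M_(b+1)]: modulo it only the part of the leading
    form of degree [b] that is free of [p] remains. *)
Definition lead_ideal b : set RQ :=
  [set x | exists2 y, M b.-1 y & M b.+1 (x - p%:R * y)].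

Lemma lead_ideal_ideal b : is_ideal (lead_ideal b).
Proof.
split.
- by exists 0; rewrite ?mulr0 ?subr0; apply: ideal0.
- move=> x x' [y My hx] [y' My' hx']; exists (y + y'); first exact: idealD.
  by rewrite mulrDr opprD addrACA; apply: idealD.
- move=> a x [y My hx]; exists (a * y); first exact: ideal_mull.
  by rewrite mulrCA -mulrBr; apply: ideal_mull.
Qed.
Hint Resolve lead_ideal_ideal : core.

Lemma loc_pow_lead b : M b.+1 `<=` lead_ideal b.
Proof. by move=> x hx; exists 0; rewrite ?mulr0 ?subr0 //; apply: ideal0. Qed.

Lemma lead_ideal_loc_pow b : lead_ideal b `<=` M b.
Proof.
move=> x [y hy hx]; apply: (ideal_subK (loc_pow_ideal _ _ _) (loc_pow_le hloc (leqnSn b) hx)).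
apply: (loc_pow_le hloc _ (loc_powM hloc loc_pow_nat hy)).
by rewrite add1n leqSpred.
Qed.

Lemma lead_idealM b x y : lead_ideal 1 x -> M b y -> lead_ideal b.+1 (x * y).
Proof.
move=> [u _ hx] hy; exists (u * y); first exact: ideal_mull.
by rewrite mulrA -mulrBl; apply: (loc_powM hloc hx hy).
Qed.

Lemma lead_ideal_mul b x y : M 1 x -> lead_ideal b y -> lead_ideal b.+1 (x * y).
Proof.
move=> hx [u hu hy]; exists (x * u).
  by apply: (loc_pow_le hloc _ (loc_powM hloc hx hu)); rewrite add1n leqSpred.
by rewrite mulrCA -mulrBr; apply: (loc_powM hloc hx hy).
Qed.

Variables (m : nat) (ev : {rmorphism {mpoly A[m]} -> R}).
Hypothesis evC : forall a, ev a%:MP = a%:A.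
Variable tau : RQ -> RQ.
Local Notation I := (lead_ideal 1).
Hypotheses (tau_res : forall x, M 1 (x - tau x))
  (tauD : forall x y, I (tau (x + y) - (tau x + tau y)))
  (tauM : forall x y, I (tau (x * y) - tau x * tau y))
  (tauA : forall a : A, I (tau (loc a%:A) - loc a%:A))
  (tau_ker : forall x, M 1 x -> I (tau x)).

Local Notation S := {mpoly R[m]}.

(** The deviation of the generators from their representatives in the
    coefficient field; substituting [zeta i * X] for the variables turns a
    Taylor expansion into a one-variable polynomial that is graded by the order
    of the differential operators. *)
Definition zeta (i : 'I_m) : RQ := loc (ev 'X_i) - tau (loc (ev 'X_i)).

Definition direction : S -> {poly RQ} :=
  mmap (@polyC RQ \o loc) (fun i => zeta i *: 'X).

HB.instance Definition _ := GRing.RMorphism.on direction.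

Lemma coef_direction F b : (direction F)`_b =
  \sum_(a <- msupp F | mdeg a == b) loc F@_a * mmap1 zeta a.
Proof.
rewrite /direction /mmap coef_sum [RHS]big_mkcond; apply: eq_bigr => a _.
have -> : mmap1 (fun i => zeta i *: 'X) a = mmap1 zeta a *: 'X^(mdeg a).
  rewrite /mmap1 mdegE -prodrXr -scaler_prod.
  by apply: eq_bigr => i _; rewrite exprZn.
rewrite /= coefCM coefZ coefXn eq_sym.
by case: ifP => _; rewrite ?mulr1 ?mulr0.
Qed.

Lemma zeta_pow a : M (mdeg a) (mmap1 zeta a).
Proof.
rewrite mdegE /mmap1; elim/big_rec2: _ => [|i x d _ hx]; first exact: loc_pow0.
apply: (loc_powM hloc) => //; elim: (a i) => [|k IH]; first exact: loc_pow0.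
by rewrite exprS -add1n; apply: (loc_powM hloc) => //; apply: tau_res.
Qed.

Lemma direction_pow F b : M b (direction F)`_b.
Proof.
rewrite coef_direction; apply: ideal_sum => // a /eqP <-.
by apply: ideal_mull => //; apply: zeta_pow.
Qed.

Lemma direction_lt F b c : var_pow c F -> (b < c)%N -> (direction F)`_b = 0.
Proof.
move=> /var_powP hF lt_bc; rewrite coef_direction big1 // => a /eqP e.
by rewrite hF ?rmorph0 ?mul0r // e.
Qed.

Lemma direction_Q F b : (forall a, mdeg a = b -> F@_a \in Q) ->
  M b.+1 (direction F)`_b.
Proof.
move=> hF; rewrite coef_direction; apply: ideal_sum => // a /eqP e.
rewrite -add1n -e; apply: (loc_powM hloc); last exact: zeta_pow.
by apply/(loc_pow_symb hloc); rewrite symb1; apply: hF.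
Qed.

Lemma direction_const r : direction r%:MP = (loc r)%:P.
Proof. by rewrite /direction mmapC. Qed.

(** Evaluated at [-1], the direction of [q (y + X)] is
    [q (y - zeta) = q (tau y)]. *)
Lemma direction_taylor q : I ((direction (taylor ev q)).[-1] - tau (loc (ev q))).
Proof.
elim/mpoly_ring_ind: q => [a|i|q q' hq hq'|q q' hq hq'].
- by rewrite taylorC direction_const hornerC evC; apply: ideal_subC.
- rewrite taylorX rmorphD /= direction_const /direction mmapX mmap1U !hornerE.
  by rewrite /zeta mulrN1 opprB addrCA subrr addr0 subrr; apply: ideal0.
- rewrite !rmorphD /= hornerD.
  apply: (ideal_trans _ (ideal_add_congr _ hq hq')) => //.
  exact: ideal_subC.
- rewrite !rmorphM /= hornerM.
  apply: (ideal_trans _ (ideal_mul_congr _ hq hq')) => //.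
  exact: ideal_subC.
Qed.

Lemma direction_high F : var_pow 2 F -> I (direction F).[-1].
Proof.
move=> hF; rewrite horner_coef; apply: ideal_sum => // i _.
apply: ideal_mulr => //; apply: loc_pow_lead.
have [lt_i2|le_2i] := ltnP i 2.
  by rewrite (direction_lt hF lt_i2); apply: ideal0.
exact: (loc_pow_le hloc le_2i (direction_pow _ _)).
Qed.

Variables (N : nat) (V : R -> S).
Hypotheses (hV : hom_mod (fun a : A => (a%:A)%:MP) (var_pow N.+1) V)
  (V1 : forall r, var_pow 1 (V r - r%:MP)) (N_gt0 : (0 < N)%N)
  (Vfrac : forall r, exists q q', [/\ exists u, ev q' * u = 1,
     r * ev q' = ev q & var_pow N.+1 (V r * taylor ev q' - taylor ev q)]).

Local Notation Phi r := (direction (V r)).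

(** The retraction [tau] can therefore be computed from the Taylor expansion;
    fractions are handled by uniqueness of quotients. *)
Lemma Phi_tau r : I ((Phi r).[-1] - tau (loc r)).
Proof.
have [q [q' [[u hu] e h]]] := Vfrac r.
have h2 : var_pow 2 (V r * taylor ev q' - taylor ev q).
  by apply: var_pow_le h; rewrite ltnS.
have tau1 : I (tau 1 - 1).
  by have := tauA 1; rewrite scale1r rmorph1.
have inv : I (tau (loc (ev q')) * tau (loc u) - 1).
  apply: (ideal_trans _ (ideal_subC _ (tauM _ _))) => //.
  by rewrite -rmorphM hu rmorph1.
set x := (Phi r).[-1] - tau (loc r).
have -> : x = x * tau (loc (ev q')) * tau (loc u)
  - x * (tau (loc (ev q')) * tau (loc u) - 1) by ring.
apply: idealB => //; last exact: ideal_mull.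
apply: ideal_mulr => //; rewrite /x mulrBl.
have i1 := direction_high h2.
rewrite rmorphB rmorphM /= hornerD hornerN hornerM in i1.
have i2 : I ((Phi r).[-1] * (direction (taylor ev q')).[-1]
           - (Phi r).[-1] * tau (loc (ev q'))).
  by rewrite -mulrBr; apply: ideal_mull => //; apply: direction_taylor.
apply: (ideal_trans _ (ideal_subC _ i2)) => //.
apply: (ideal_trans _ i1) => //.
apply: (ideal_trans _ (direction_taylor q)) => //.
by rewrite -e rmorphM; apply: tauM.
Qed.

Lemma Phi0 r : (Phi r)`_0 = loc r.
Proof.
have := direction_lt (V1 r) (ltn0Sn 0).
by rewrite rmorphB /= direction_const coefB coefC => /subr0_eq.
Qed.

(** The first order part of the Taylor expansion of an element of [Q] is that
    element, up to [p] and second order: this is the injectivity of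
    [Q / (Q ^ 2 + p) -> Omega], which rests on separability. *)
Lemma Phi1 q : q \in Q -> I ((Phi q)`_1 - loc q).
Proof.
move=> hq; have locq : M 1 (loc q) by apply/(loc_pow_symb hloc); rewrite symb1.
have h := ideal_subK (lead_ideal_ideal 1) (Phi_tau q) (tau_ker locq).
have : I ((Phi q).[-1] - ((Phi q)`_0 - (Phi q)`_1)).
  rewrite (horner_coef_wide (n := (size (Phi q)).+2)); last by rewrite !leqW.
  rewrite !big_ord_recl /= /bump /= addn0; set rest := \sum_(_ < _) _.
  have -> : (Phi q)`_0 * (-1) ^+ 0 + ((Phi q)`_1 * (-1) ^+ 1 + rest)
    - ((Phi q)`_0 - (Phi q)`_1) = rest by ring.
  apply: ideal_sum => // i _.
  apply: ideal_mulr => //; apply: loc_pow_lead.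
  by apply: (loc_pow_le hloc _ (direction_pow _ _)).
rewrite Phi0 => h'; have := idealB (lead_ideal_ideal 1) h' h.
by rewrite addrAC subrr add0r opprB.
Qed.

Lemma PhiM r s i : (i <= N)%N ->
  (Phi (r * s))`_i = \sum_(l < i.+1) (Phi r)`_l * (Phi s)`_(i - l).
Proof.
move=> le_iN; have [_ hM _] := hV; rewrite -coefM -rmorphM.
apply/subr0_eq; rewrite -coefB -rmorphB.
by apply: direction_lt (hM r s) _; rewrite ltnS.
Qed.

Lemma PhiD r s i : (i <= N)%N -> (Phi (r + s))`_i = (Phi r)`_i + (Phi s)`_i.
Proof.
move=> le_iN; have [hD _ _] := hV; rewrite -coefD -rmorphD.
apply/subr0_eq; rewrite -coefB -rmorphB.
by apply: direction_lt (hD r s) _; rewrite ltnS.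
Qed.

Lemma Phi_00 i : (i <= N)%N -> (Phi 0)`_i = 0.
Proof. by move=> h; apply: (addrI (Phi 0)`_i); rewrite -PhiD // !addr0. Qed.

Lemma Phi_pow_ge b h i : ideal_pow [set` Q] b h -> (i <= N)%N ->
  M (maxn b i) (Phi h)`_i.
Proof.
elim: b h i => [|b IH] h i hh le_iN; first by rewrite max0n; apply: direction_pow.
move: h hh i le_iN.
apply: (ideal_pow_ind_add (P := [set h | forall i, (i <= N)%N -> M (maxn b.+1 i) (Phi h)`_i])).
- by move=> i hi; rewrite Phi_00 //; apply: ideal0.
- by move=> x y hx hy i hi; rewrite PhiD //; apply: idealD => //; [apply: hx | apply: hy].
move=> q h hq hh i hi; rewrite PhiM //; apply: ideal_sum => // l _.
have le_li : (l <= i)%N by rewrite -ltnS.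
have hl : M (maxn 1 l) (Phi q)`_l.
  case: (posnP l) => [->|l_gt0]; last by rewrite (maxn_idPr l_gt0); apply: direction_pow.
  by rewrite maxn0 Phi0; apply/(loc_pow_symb hloc); rewrite symb1.
have hil := IH h (i - l)%N hh (leq_trans (leq_subr _ _) hi).
by apply: (loc_pow_le hloc _ (loc_powM hloc hl hil)); lia.
Qed.

(** For a product of [b] elements of [Q], the part of order [b] of the Taylor
    expansion is the product of the parts of order one, up to higher order, and
    these are given by [Phi1]. *)
Lemma Phi_leading b h : (b <= N)%N -> ideal_pow [set` Q] b h ->
  lead_ideal b ((Phi h)`_b - loc h).
Proof.
elim: b h => [|b IH] h le_bN.
  by move=> _; rewrite Phi0 subrr; apply: ideal0.
move: h; apply: (ideal_pow_ind_add (P := [set h | lead_ideal b.+1 ((Phi h)`_b.+1 - loc h)])) => /=.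
- by rewrite Phi_00 // rmorph0 subrr; apply: ideal0.
- by move=> x y hx hy; rewrite PhiD // rmorphD; apply: ideal_add_congr.
move=> q h hq hh; rewrite PhiM // rmorphM.
have hle := ltnW le_bN; have IHh := IH h hle hh.
have locq : M 1 (loc q) by apply/(loc_pow_symb hloc); rewrite symb1.
rewrite !big_ord_recl /= /bump /= !subn0 subSS subn0.
set rest := \sum_(_ < _) _; rewrite Phi0.
have hrest : M b.+2 rest.
  apply: ideal_sum => // l _ /=.
  have hq2 := direction_pow (V q) (1 + (1 + l)).
  have hbl := Phi_pow_ge hh (leq_trans (leq_subr (1 + (1 + l)) b.+1) le_bN).
  by apply: (loc_pow_le hloc _ (loc_powM hloc hq2 hbl)); lia.
have h0 : M b.+2 (loc q * (Phi h)`_b.+1).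
  apply: (loc_pow_le hloc _ (loc_powM hloc locq (Phi_pow_ge hh le_bN))); lia.
have hb : M b (Phi h)`_b by have := Phi_pow_ge hh hle; rewrite maxnn.
have -> : loc q * (Phi h)`_b.+1 + ((Phi q)`_1 * (Phi h)`_b + rest) - loc q * loc h
  = (loc q * (Phi h)`_b.+1 + rest) + ((Phi q)`_1 - loc q) * (Phi h)`_b
    + loc q * ((Phi h)`_b - loc h) by ring.
apply: idealD => //; last exact: lead_ideal_mul.
apply: idealD => //; first by apply: loc_pow_lead; apply: idealD.
by apply: lead_idealM => //; apply: Phi1.
Qed.

(** The part of order [b] of the Taylor expansion is at once [h], by
    [Phi_leading], and of higher order, as its coefficients lie in [Q]. *)
Lemma taylor_detects b h : (b <= N)%N -> ideal_pow [set` Q] b h ->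
  (forall a, mdeg a = b -> (V h)@_a \in Q) ->
  exists w h', [/\ w \notin Q, ideal_pow [set` Q] b.-1 h'
    & symb Q b.+1 (w * h - p%:R * h')].
Proof.
move=> le_bN hh hQ; have := idealB (lead_ideal_ideal b)
  (loc_pow_lead (direction_Q hQ)) (Phi_leading le_bN hh).
rewrite subKr => -[y /(loc_powP hloc)[w [h' [hw hh' e]]] hy].
exists w, h'; split=> //; apply/(loc_pow_symb hloc).
rewrite rmorphB !rmorphM /= -e rmorph_nat.
have -> : loc w * loc h - p%:R * (y * loc w) = loc w * (loc h - p%:R * y) by ring.
exact: ideal_mull.
Qed.

End LeadingForms.
(** * Symbolic and mixed differential powers *)

Section MixedPowers.
Variables (A : comNzRingType) (R : comAlgType A) (Q : prime_idealr R) (p : nat).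
Hypotheses (p_prime : prime p) (pQ : p%:R \in Q).
Hypothesis p_reg : forall x : R, p%:R * x = 0 -> x = 0.

Lemma symb_full_mixed n : (0 < n)%N -> symb Q n `<=` full_mixed_power p [set` Q] n.
Proof.
move=> n_gt0 f hf a b le_ab eta d [t le_ta heta] hd.
rewrite -symb1 /=; have := p_derivation_comp_symb p_prime pQ p_reg heta (diffop_symb hd hf).
by apply: symb_le; lia.
Qed.

Lemma full_mixed_mixed delta n : p_derivation p delta ->
  full_mixed_power p [set` Q] n `<=` mixed_power delta [set` Q] n.
Proof.
move=> hdelta f hf s t le_st d hd; apply: (hf s t) => //.
by exists s => //; apply: iter_p_derivation_comp.
Qed.

(** Suppose that, up to higher order, elements of [Q ^ b] that all operators of
    order [b] send into [Q] are multiples of [p].  An element [f] of the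
    [N.+1]-st mixed power lies in the [N]-th symbolic power by induction; its
    leading form is shown to be divisible by [p ^ a], for increasing [a].  If
    [w f = p ^ a h + e] with [e] of order [N.+1], an operator [d] of order
    [N - a] gives [d (w f) = p ^ a d h] up to order [a.+1], and the [a]-fold
    iterate of the p-derivation would not be in [Q] if [d h] were not. *)
Lemma mixed_symb (delta : R -> R) n : p_derivation p delta ->
  (forall b h, ideal_pow [set` Q] b h ->
     (forall d, @diffop A R b d -> d h \in Q) ->
     exists w h', [/\ w \notin Q, ideal_pow [set` Q] b.-1 h'
       & symb Q b.+1 (w * h - p%:R * h')]) ->
  mixed_power delta [set` Q] n `<=` symb Q n.
Proof.
move=> hdelta detect; elim: n => [|N IH] f hf.
  by exists 1; rewrite ?notin_prime1.
have hfN : symb Q N f by apply: IH => s t le_st; apply: hf; lia.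
have pX a x : p%:R ^+ a * x = ((p ^ a)%:R : A) *: x.
  by rewrite -natrX mulr_natl scaler_nat.
have kill a w h e d : (a <= N)%N -> symb Q N.+1 e -> w * f = p%:R ^+ a * h + e ->
    @diffop A R (N - a) d -> d h \in Q.
  move=> le_aN he ef hd; apply: contraT => hdh.
  have le : (a + (N - a) <= N.+1 - 1)%N by lia.
  have := hf a (N - a)%N le _ (diffop_premul w hd); rewrite /= ef.
  have -> : d (p%:R ^+ a * h + e) = p%:R ^+ a * d h + d e.
    by rewrite !pX (diffop_linear hd).
  apply: contraLR => _; apply: (iter_pder_unit p_prime pQ p_reg) => //.
  by apply: symb_le (diffop_symb hd he); lia.
have step a : (a <= N)%N -> exists w h e, [/\ w \notin Q,
    ideal_pow [set` Q] (N - a) h, symb Q N.+1 e & w * f = p%:R ^+ a * h + e].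
  elim: a => [|a IHa] le_aN.
    case: hfN => w hw hwf; exists w, (w * f), 0.
    by rewrite subn0 mul1r addr0; split=> //; apply: ideal0.
  have [w [h [e [hw hh he ef]]]] := IHa (ltnW le_aN).
  have [d hd|w' [h' [hw' hh' hs]]] := detect _ _ hh.
    exact: (kill a w h e d (ltnW le_aN)).
  exists (w' * w), h', (p%:R ^+ a * (w' * h - p%:R * h') + w' * e); split.
  - exact: notin_primeM.
  - by rewrite subnS.
  - apply: idealD => //; last exact: ideal_mull.
    by apply: symb_le (symbM (natX_symb pQ a) hs); lia.
  - by rewrite -mulrA ef exprS; ring.
have [w [h [e [hw _ he ef]]]] := step N (leqnn N).
apply: (symb_cancel hw); rewrite ef; apply: idealD => //.
have hQ : symb Q 1 h.
  rewrite symb1; apply: (kill N w h e id (leqnn N) he ef).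
  by rewrite subnn; apply: diffop_id.
by apply: symb_le (symbM (natX_symb pQ N) hQ); lia.
Qed.

End MixedPowers.
(** * The base ring *)

Lemma principal_ideals_set (A : comNzRingType) (I : set A) :
  principal_ideals A -> is_ideal I -> exists a, I = gen_ideal [set a].
Proof.
move=> hA iI; have [I1|nI1] := pselect (I 1).
  exists 1; apply/seteqP; split=> x _; last by rewrite -[x]mulr1; apply: ideal_mull.
  by apply/gen_ideal1; exists x; rewrite mulr1.
have [a ha] := hA (ideal_pred iI nI1); exists a; rewrite -ha.
by apply/seteqP; split=> x /=; move/asboolP.
Qed.

Section BaseRing.
Variables (A : idomainType) (p : nat).
Hypothesis hA : iso_int A \/ (discrete_valuation_ring A /\ uniformizer (p%:R : A)).

Lemma base_noetherian : noetherian A.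
Proof.
case: hA => [[f [g _ gK]]|[[prA _] _]]; last first.
  by apply: principal_noetherian => I iI; apply: principal_ideals_set.
apply: (@noetherian_surj _ _ f); first by move=> y; exists (g y).
exact: principal_noetherian int_principal.
Qed.

Lemma base_p_neq0 : prime p -> p%:R != 0 :> A.
Proof.
move=> p_pr; case: hA => [[f [g fK _]]|[[_ [m [mmax [x mx x0] _]]] unif]].
  rewrite -(rmorph_nat f) -(rmorph0 f) (can_eq fK).
  by rewrite Num.Theory.pnatr_eq0 -lt0n prime_gt0.
apply: contra_neq x0 => p0; have : [set` m] x by [].
by rewrite (unif m mmax) p0 => /gen_ideal1[c ->]; rewrite mulr0.
Qed.
End BaseRing.

(** * Zariski-Nagata in mixed characteristic *)

Section Detection.
Variables (p : nat) (A : idomainType).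
Variables (noeA : noetherian A) (R : comAlgType A) (hR : essentially_smooth R).
Variables (Q : prime_idealr R) (pQ : p%:R \in Q).
Variables (RQ : comNzRingType) (loc : {rmorphism R -> RQ}).
Hypothesis hloc : is_localization_at Q loc.
Variables (k K : fieldType) (piA : {rmorphism A -> k}).
Hypothesis hk : is_quotient (gen_ideal [set p%:R]) piA.
Variable piQ : {rmorphism RQ -> K}.
Hypothesis hK : is_quotient (ideal_ext loc [set` Q]) piQ.
Variable iota : {rmorphism k -> K}.
Hypothesis hiota : forall a : A, iota (piA a) = piQ (loc a%:A).
Hypothesis hsep : separable_extension iota.

(** The separability hypothesis speaks of finitely generated subextensions; it
    applies to the whole residue field, which is generated by the classes of
    the variables. *)
Lemma residue_field_generated m (ev : {rmorphism {mpoly A[m]} -> R}) :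
  (forall a, ev a%:MP = a%:A) ->
  (forall r, exists q q', (exists u, ev q' * u = 1) /\ r * ev q' = ev q) ->
  forall z, adjoin iota [set` [seq piQ (loc (ev 'X_i)) | i : 'I_m]] z.
Proof.
move=> evC frac z F hk' hs.
have hq q : piQ (loc (ev q)) \in F.
  elim/mpoly_ring_ind: q => [a|i|x y hx hy|x y hx hy].
  - by rewrite evC -hiota.
  - by apply: hs => /=; apply: map_f; rewrite mem_enum.
  - by rewrite !rmorphD rpredD.
  - by rewrite !rmorphM rpredM.
have hr r : piQ (loc r) \in F.
  have [q [q' [[u hu] e]]] := frac r.
  have q'0 : piQ (loc (ev q')) != 0.
    apply/eqP => h; have := congr1 (piQ \o loc) hu; rewrite /= !rmorphM !rmorph1 h.
    by rewrite mul0r => /esym/eqP; rewrite oner_eq0.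
  have -> : piQ (loc r) = piQ (loc (ev q)) / piQ (loc (ev q')).
    by apply: (mulIf q'0); rewrite divfK // -!rmorphM e.
  by rewrite rpred_div.
case: hK => piQ_surj _; have [x <-] := piQ_surj z.
case: hloc => _ _ fracQ _; have [b [v [/= hv e]]] := fracQ x.
have v0 : piQ (loc v) != 0 by apply: contra hv => /eqP/(residue_loc hloc hK).
have -> : piQ x = piQ (loc b) / piQ (loc v).
  by apply: (mulIf v0); rewrite divfK // -rmorphM e.
by rewrite rpred_div.
Qed.

(** The combination of the coefficient field, which depends on separability, and
    of the Taylor expansion, which depends on smoothness. *)
Lemma operators_detect b h : ideal_pow [set` Q] b h ->
  (forall d, @diffop A R b d -> d h \in Q) ->
  exists w h', [/\ w \notin Q, ideal_pow [set` Q] b.-1 h'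
    & symb Q b.+1 (w * h - p%:R * h')].
Proof.
move=> hh hd; case: hR => _ smooth ft.
have [m [ev [evC frac]]] := ess_finite_presentation ft.
have [V [hV V1 Vfrac]] := smooth_taylor evC smooth frac noeA b.+1.
pose I := lead_ideal Q loc p 1.
have iI : is_ideal I by apply: lead_ideal_ideal.
have [piA_surj piA_ker] := hk; have [piQ_surj _] := hK.
have I_ker x : I x -> piQ x = 0.
  by move/(lead_ideal_loc_pow hloc pQ)/(residue0 hK).
have I_sq x y : piQ x = 0 -> piQ y = 0 -> I (x * y).
  move=> /(residue0 hK) hx /(residue0 hK) hy; apply: loc_pow_lead.
  exact: (loc_powM hloc hx hy).
have I_A a : piA a = 0 -> I ((loc \o in_alg R)%FUN a).
  move=> /piA_ker/gen_ideal1[c ->]; exists (loc c%:A); first exact: (loc_pow0 hloc).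
  rewrite /= -[(c * _)%:A]/(in_alg R (c * p%:R)) !rmorphM !rmorph_nat mulrC subrr.
  exact: ideal0.
have local := local_unit hloc hK.
have Lall := residue_field_generated evC frac.
have [tau [tau_pi tauD tauM tauA tau_ker]] :=
  coefficient_field (jQ := (loc \o in_alg R)%FUN) piA_surj piQ_surj
  hiota local iI I_ker I_sq I_A Lall (hsep _).
apply: (taylor_detects hloc pQ evC _ tauD tauM tauA _ hV V1 _ Vfrac) => //.
- by move=> x; apply/(residue0 hK); rewrite rmorphB tau_pi subrr.
- by move=> x /(residue0 hK) x0; exact: (tau_ker x x0).
move=> a ea; apply: (hd (fun r => (V r)@_a)).
have := taylor_diffop (c := 0) (W := 1) (t := b) (a := a) hV V1 (var_pow0 _).
by rewrite add0n ea => /(_ erefl (leqnSn b)); under eq_fun do rewrite mul1r.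
Qed.

End Detection.

Theorem corollary3p25
  (p : nat) (p_prime : prime p)
  (A : idomainType)
  (hA : iso_int A \/
        (discrete_valuation_ring A /\ uniformizer (p%:R : A)))
  (R : comAlgType A)
  (hR : essentially_smooth R)
  (hdelta : exists delta : R -> R, p_derivation p delta)
  (Q : prime_idealr R) (pQ : p%:R \in Q)
  (* RQ is the local ring R_Q *)
  (RQ : comNzRingType) (loc : {rmorphism R -> RQ})
  (hloc : is_localization_at Q loc)
  (* k = A / pA and K = R_Q / Q R_Q, with the induced map iota : k -> K *)
  (k K : fieldType)
  (piA : {rmorphism A -> k}) (hk : is_quotient (gen_ideal [set p%:R]) piA)
  (piQ : {rmorphism RQ -> K}) (hK : is_quotient (ideal_ext loc [set` Q]) piQ)
  (iota : {rmorphism k -> K})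
  (hiota : forall a : A, iota (piA a) = piQ (loc a%:A))
  (hsep : separable_extension iota)
  (n : nat) (hn : (1 <= n)%N) :
  (forall delta delta' : R -> R,
     p_derivation p delta -> p_derivation p delta' ->
     mixed_power delta [set` Q] n = mixed_power delta' [set` Q] n) /\
  (forall delta : R -> R, p_derivation p delta ->
     symbolic_power loc Q n = mixed_power delta [set` Q] n /\
     mixed_power delta [set` Q] n = full_mixed_power p [set` Q] n).
Proof.
have noeA := base_noetherian hA.
have p_reg (x : R) : p%:R * x = 0 -> x = 0.
  case: hR => _ smooth ft; have [m [ev [evC frac]]] := ess_finite_presentation ft.
  move=> px; apply: (regular_scalar evC smooth frac noeA (base_p_neq0 hA p_prime)).
  by rewrite scaler_nat.
have detect := operators_detect noeA hR pQ hloc hk hK hiota hsep.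
have mixedE delta : p_derivation p delta -> mixed_power delta [set` Q] n = symb Q n.
  move=> hd; apply/seteqP; split; first exact: (mixed_symb p_prime pQ p_reg hd detect).
  apply: subset_trans (full_mixed_mixed hd).
  exact: (symb_full_mixed p_prime pQ p_reg hn).
split=> [delta delta' hd hd'|delta hd]; first by rewrite !mixedE.
rewrite (symbolic_power_symb hloc) mixedE //; split=> //.
apply/seteqP; split; first exact: (symb_full_mixed p_prime pQ p_reg hn).
by rewrite -(mixedE _ hd); apply: full_mixed_mixed.
Qed.
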